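(* Let $t_1<t_2<t_1+1$ and $p_1<p_2<p_1+1$ be real numbers (representing points of the circle $\mathbb{T}$), and let $q_1,q_2>0$. Let $\psi:[t_1,t_2]\to[p_1,p_2]$ be the minimizer (i.e. the restriction to $[t_1,t_2]$ of a minimizer) of the functional $$\phi\mapsto\frac12\int_{t_1}^{t_2}\left[\big((\log\phi'(\tau))'\big)^2-4\pi^2\phi'(\tau)^2\right]d\tau$$ on the space $\mathsf{H}(\mathbb{T})$ under the constraints $$\phi(t_1)=p_1,\quad \phi(t_2)=p_2,\quad \phi'(t_1)=q_1,\quad \phi'(t_2)=q_2 .$$ Denote $$\varkappa:=\frac{\pi\sqrt{q_1q_2}\,(t_2-t_1)}{\sin(\pi(p_2-p_1))}.$$ Then for some $a,b,c,d\in\mathbb{R}$ with $ad-bc=1$ and any $\tau\in[t_1,t_2]$: 1. If $\varkappa>1$, then $$\tan(\pi\psi(\tau))=\frac{a\tan(\lambda\tau)+b}{c\tan(\lambda\tau)+d},$$ where $\lambda\in(0,\pi/(t_2-t_1))$ is such that $\dfrac{\lambda(t_2-t_1)}{\sin(\lambda(t_2-t_1))}=\varkappa$. 2. If $\varkappa=1$, then $$\tan(\pi\psi(\tau))=\frac{a\tau+b}{c\tau+d}.$$ 3. If $\varkappa<1$, then $$\tan(\pi\psi(\tau))=\frac{a\tanh(\lambda\tau)+b}{c\tanh(\lambda\tau)+d},$$ where $\lambda>0$ is such that $\dfrac{\lambda(t_2-t_1)}{\sinh(\lambda(t_2-t_1))}=\varkappa$.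
   Context: $\mathbb{T}=[0,1]/\{0\sim1\}$ is the unit circle. $\mathrm{Diff}^1(\mathbb{T})$ is the space of orientation preserving $C^1$-diffeomorphisms of $\mathbb{T}$, identified with $C^1$ maps $\phi:\mathbb{R}\to\mathbb{R}$ satisfying $\phi(\tau+1)=\phi(\tau)+1$ and $\phi'>0$. $\mathsf{H}(\mathbb{T})=\{\phi\in\mathrm{Diff}^1(\mathbb{T}):\log\phi'\in H^1(\mathbb{T})\}$, where $H^1(\mathbb{T})$ is the Sobolev space, and $(\log\phi')'$ denotes the weak derivative. The equalities for $\tan(\pi\psi(\tau))$ are understood in $\mathbb{R}\cup\{\infty\}$, with the usual conventions for $\tan$ and fractional linear maps at poles. The points $t_1,t_2$ and $p_1,p_2$ are distinct points of the circle, in each pair in increasing (anticlockwise) order. *)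

(* Defs.v *)
From HB Require Import structures.
From mathcomp Require Export all_boot all_order all_algebra.
From mathcomp Require Export all_classical all_reals all_analysis.
Export Order.TTheory GRing.Theory Num.Theory.
Export numFieldNormedType.Exports.

Set Implicit Arguments.
Unset Strict Implicit.
Unset Printing Implicit Defensive.

Local Open Scope ring_scope.
Local Open Scope classical_set_scope.

(* Functions on the circle T = [0,1]/{0~1} are represented by 1-periodic
   functions on R, and integrals over T by integrals over [0, 1]. *)

Definition in_L2T (R : realType) (f : R -> R) : Prop :=
  [/\ periodic f 1,
      measurable_fun [set: R] f &
      (@lebesgue_measure R).-integrable `[0%R, 1%R]
        (fun x : R => (f x ^+ 2)%:E)].

Definition in_C1T (R : realType) (f : R -> R) : Prop :=
  [/\ periodic f 1,
      forall x, derivable f x 1 &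
      continuous (derive1 f : R -> R)].

Definition is_weak_derivative (R : realType) (f g : R -> R) : Prop :=
  forall eta : R -> R, in_C1T eta ->
    \int[@lebesgue_measure R]_(x in `[0%R, 1%R]) (f x * derive1 eta x) =
    - \int[@lebesgue_measure R]_(x in `[0%R, 1%R]) (g x * eta x).

Definition in_H1T (R : realType) (f : R -> R) : Prop :=
  in_L2T f /\ exists2 g : R -> R, in_L2T g & is_weak_derivative f g.

(* A representative of the weak derivative of f in L^2(T), which is unique up
   to equality almost everywhere. Outside of H^1(T) the value is junk. *)
Definition weak_derivative (R : realType) (f : R -> R) : R -> R :=
  xget (fun _ : R => 0) [set g : R -> R | in_L2T g /\ is_weak_derivative f g].

(* An orientation preserving C^1-diffeomorphism of T is represented by its
   lifts to R. *)
Definition Diff1 (R : realType) : set (R -> R) :=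
  [set phi : R -> R | [/\ forall x, derivable phi x 1,
                 continuous (derive1 phi : R -> R),
                 forall x, phi (x + 1) = phi x + 1 &
                 forall x, 0 < derive1 phi x]].

Definition log_deriv (R : realType) (phi : R -> R) : R -> R :=
  fun x => ln (derive1 phi x).

Definition HT (R : realType) : set (R -> R) :=
  [set phi : R -> R | Diff1 phi /\ in_H1T (log_deriv phi)].

Definition action (R : realType) (t1 t2 : R) (phi : R -> R) : R :=
  2^-1 * \int[@lebesgue_measure R]_(x in `[t1, t2])
    (weak_derivative (log_deriv phi) x ^+ 2 - 4 * pi ^+ 2 * derive1 phi x ^+ 2).

Definition admissible (R : realType) (t1 t2 p1 p2 q1 q2 : R) : set (R -> R) :=
  [set phi : R -> R | HT phi /\
    [/\ phi t1 = p1, phi t2 = p2, derive1 phi t1 = q1 & derive1 phi t2 = q2]].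

Definition is_minimizer (R : realType) (U : Type) (F : U -> R) (A : set U)
    (x : U) : Prop :=
  A x /\ forall y, A y -> F x <= F y.

Definition sinh (R : realType) (x : R) : R := (expR x - expR (- x)) / 2.
Definition cosh (R : realType) (x : R) : R := (expR x + expR (- x)) / 2.
Definition tanh (R : realType) (x : R) : R := sinh x / cosh x.

(* The projective line R \cup {oo} is [option R], with [None] for oo. *)
Definition ptan (R : realType) (x : R) : option R :=
  if cos x == 0 then None else Some (tan x).

Definition moebius (R : realType) (a b c d : R) (z : option R) : option R :=
  match z with
  | Some x =>
      if c * x + d == 0 then None else Some ((a * x + b) / (c * x + d))
  | None => if c == 0 then None else Some (a / c)
  end.

(* Main.v *)
(** Let u = log phi' and let g be its weak derivative. Varying phi to
    phi + eps theta with theta' = phi' zeta and zeta supported in [t1, t2]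
    replaces u by u + ln (1 + eps zeta), so minimality gives
      int (g zeta' - 4 pi^2 phi'^2 zeta) = 0   whenever   int phi' zeta = 0.
    Moving one more derivative onto the test function leaves only continuous
    functions, and the du Bois-Reymond argument (testing with the weighted
    projection of the residual orthogonal to 1, x and int phi) shows that
    u is C^2 on [t1, t2] with u'' = c phi' - 4 pi^2 phi'^2. Then
    m = (c phi' - 2 pi^2 phi'^2 - u'^2 / 2) / 2, half the Schwarzian of
    tan (pi phi), is constant and phi'^(-1/2) sin (pi phi) and
    phi'^(-1/2) cos (pi phi) solve y'' = - m y, so their quotient is a Moebius
    transformation of tan, the identity or tanh according to the sign of m.
    The boundary data give kappa = lambda T / sin (lambda T), 1 or
    lambda T / sinh (lambda T) with T = t2 - t1, which identifies the case and,
    by monotonicity, lambda. *)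

(* The weak derivative is an L^2 class, and [action] evaluates it through an arbitrarily selected
   representative. The action of a perturbed map therefore becomes computable only through
   uniqueness almost everywhere on [t1, t2]. The first variation then rests on a one-sided bound of
   the action, quadratic in eps, applied for both signs of eps. Admissible perturbations live on the
   circle while the argument takes place on [t1, t2]. Since t2 < t1 + 1, functions vanishing off
   ]t1, t2[ extend periodically and keep their smoothness. The constant c is the Lagrange multiplier
   of the constraint phi(t2) = p2. That constraint restricts zeta by one linear condition, which two
   integrations by parts turn into orthogonality to int phi. The coefficients of a solution of y'' =
   - m y in a fundamental pair are conserved quantities, and this identifies the solutions. The
   resulting formula for sin (pi (phi - p1)) is used twice: at t2 it gives kappa, and its positivity
   on ]t1, t2] forces lambda T < pi in the trigonometric case. *)
From mathcomp Require Import ring lra.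
From mathcomp Require Import measurable_realfun.
Require Import Defs.

Set Implicit Arguments.
Unset Strict Implicit.
Unset Printing Implicit Defensive.

Local Open Scope ring_scope.
Local Open Scope classical_set_scope.

(** * Calculus of continuous functions *)

(* [is_derive] is a type class: with it, instance resolution rather than the
   lemmas below would choose the form of the derivative. *)
Definition has_derivative (R : realType) (f : R -> R) (x a : R) : Prop :=
  is_derive x (1 : R) f a.

Section derivatives.
Context {R : realType}.
Implicit Types (f g : R -> R) (x a b : R).

Lemma has_derivative_eq f x a b :
  has_derivative f x a -> a = b -> has_derivative f x b.
Proof. by move=> ? <-. Qed.

Lemma has_derivativeM f g x a b :
  has_derivative f x a -> has_derivative g x b ->
  has_derivative (fun t => f t * g t) x (a * g x + f x * b).
Proof.
move=> fa gb; apply: (has_derivative_eq (is_deriveM fa gb)).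
by rewrite addrC mulrC.
Qed.

Lemma has_derivativeD f g x a b :
  has_derivative f x a -> has_derivative g x b ->
  has_derivative (fun t => f t + g t) x (a + b).
Proof. exact: is_deriveD. Qed.

Lemma has_derivativeN f x a : has_derivative f x a ->
  has_derivative (fun t => - f t) x (- a).
Proof. exact: is_deriveN. Qed.

Lemma has_derivative_cst x a : has_derivative (fun=> a) x 0.
Proof. exact: is_derive_cst. Qed.

Lemma has_derivative_id x : has_derivative (fun t => t) x 1.
Proof. exact: is_derive_id. Qed.

Lemma has_derivative_comp f g x a b :
  has_derivative g (f x) b -> has_derivative f x a ->
  has_derivative (fun t => g (f t)) x (b * a).
Proof. exact: is_derive1_comp. Qed.

Lemma has_derivative_expR f x a : has_derivative f x a ->
  has_derivative (fun t => expR (f t)) x (expR (f x) * a).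
Proof. by apply: has_derivative_comp; exact: is_derive_expR. Qed.

Lemma has_derivative_sin f x a : has_derivative f x a ->
  has_derivative (fun t => sin (f t)) x (cos (f x) * a).
Proof. by apply: has_derivative_comp; exact: is_derive_sin. Qed.

Lemma has_derivative_cos f x a : has_derivative f x a ->
  has_derivative (fun t => cos (f t)) x (- sin (f x) * a).
Proof. by apply: has_derivative_comp; exact: is_derive_cos. Qed.

Lemma has_derivative_ln f x a : 0 < f x -> has_derivative f x a ->
  has_derivative (fun t => ln (f t)) x ((f x)^-1 * a).
Proof. by move=> f0; apply: has_derivative_comp; exact: is_derive1_ln. Qed.

Lemma has_derivativeV f x a : f x != 0 -> has_derivative f x a ->
  has_derivative (fun t => (f t)^-1) x (- (f x) ^- 2 * a).
Proof. exact: is_deriveV. Qed.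

Lemma has_derivative_sqr f x a : has_derivative f x a ->
  has_derivative (fun t => f t ^+ 2) x (2 * f x * a).
Proof.
move=> fa; apply: (has_derivative_eq (has_derivativeM fa fa)); ring.
Qed.

Lemma has_derivative_continuous f x a : has_derivative f x a ->
  {for x, continuous f}.
Proof.
by case=> fx _; exact/differentiable_continuous/derivable1_diffP.
Qed.

Lemma has_derivative_derivable f x a : has_derivative f x a -> derivable f x 1.
Proof. by case. Qed.

Lemma has_derivative_derive1 f x a : has_derivative f x a -> derive1 f x = a.
Proof. by move=> fa; rewrite derive1E; case: fa. Qed.

Lemma derivable_has_derivative f x : derivable f x 1 ->
  has_derivative f x (derive1 f x).
Proof. by move=> fx; rewrite derive1E; exact: derivableP. Qed.

Lemma has_derivative_near f g x a : (\near x, f x = g x) ->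
  has_derivative f x a -> has_derivative g x a.
Proof. exact: near_eq_is_derive. Qed.

Lemma has_derivative0_segment f a b : a <= b ->
  (forall x, a <= x <= b -> has_derivative f x 0) -> f b = f a.
Proof.
move=> ab fD; have [| |c _] := @MVT_segment _ f (fun=> 0) _ _ ab.
- by move=> x; rewrite in_itv/= => /andP[ax xb]; apply: fD; rewrite !ltW.
- apply: continuous_in_subspaceT => x; rewrite inE/= in_itv/= => xab.
  exact: has_derivative_continuous (fD _ xab).
- by rewrite mul0r => /eqP; rewrite subr_eq0 => /eqP.
Qed.

End derivatives.

(* Dispatching on the syntax of the goal prevents the unifier from unfolding
   [sin], [expR], etc. *)
Ltac derive_auto :=
  lazymatch goal with
  | H : forall y, has_derivative ?f y _ |- has_derivative ?f _ _ => exact: H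
  | H : has_derivative ?f ?x _ |- has_derivative ?f ?x _ => exact: H
  | |- has_derivative (fun _ => ?c) _ _ => exact: (has_derivative_cst _ c)
  | |- has_derivative (fun x => x) _ _ => exact: has_derivative_id
  | |- has_derivative (fun x => @?f x + @?g x) _ _ =>
      apply: (@has_derivativeD _ f g); derive_auto
  | |- has_derivative (fun x => - @?f x) _ _ =>
      apply: (@has_derivativeN _ f); derive_auto
  | |- has_derivative (fun x => @?f x ^+ 2) _ _ =>
      apply: (@has_derivative_sqr _ f); derive_auto
  | |- has_derivative (fun x => @?f x * @?g x) _ _ =>
      apply: (@has_derivativeM _ f g); derive_auto
  | |- has_derivative (fun x => expR (@?f x)) _ _ =>
      apply: (@has_derivative_expR _ f); derive_auto
  | |- has_derivative (fun x => sin (@?f x)) _ _ =>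
      apply: (@has_derivative_sin _ f); derive_auto
  | |- has_derivative (fun x => cos (@?f x)) _ _ =>
      apply: (@has_derivative_cos _ f); derive_auto
  | |- has_derivative (fun x => ?f x) ?y ?a =>
      change (has_derivative f y a); derive_auto
  | |- has_derivative ?f _ _ => unfold f; derive_auto
  end.

Section continuity.
Context {R : realType}.
Implicit Types f g : R -> R.

Lemma continuous_addf f g : continuous f -> continuous g ->
  continuous (fun t => f t + g t).
Proof. by move=> cf cg x; apply: cvgD; [exact: cf|exact: cg]. Qed.

Lemma continuous_mulf f g : continuous f -> continuous g ->
  continuous (fun t => f t * g t).
Proof. by move=> cf cg x; apply: cvgM; [exact: cf|exact: cg]. Qed.

Lemma continuous_oppf f : continuous f -> continuous (fun t => - f t).
Proof. by move=> cf x; apply: cvgN; exact: cf. Qed.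

Lemma continuous_sqrf f : continuous f -> continuous (fun t => f t ^+ 2).
Proof. by move=> cf x; apply: cvgM; exact: cf. Qed.

Lemma continuous_invf f : (forall t, f t != 0) -> continuous f ->
  continuous (fun t => (f t)^-1).
Proof. by move=> f0 cf x; apply: cvgV; [exact: f0|exact: cf]. Qed.

Lemma continuous_maxf f g : continuous f -> continuous g ->
  continuous (fun t => Num.max (f t) (g t)).
Proof. by move=> cf cg x; apply: continuous_max; [exact: cf|exact: cg]. Qed.

Lemma continuous_compf f g : continuous f -> continuous g ->
  continuous (fun t => f (g t)).
Proof. by move=> cf cg x; apply: continuous_comp; [exact: cg|exact: cf]. Qed.

Lemma continuous_cstf (a : R) : continuous (fun _ : R => a).
Proof. by move=> x; exact: cvg_cst. Qed.

Lemma continuous_idf : continuous (fun x : R => x).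
Proof. by move=> x; exact: cvg_id. Qed.

End continuity.

Ltac cont_auto :=
  lazymatch goal with
  | H : continuous ?f |- continuous ?f => exact: H
  | |- continuous (fun _ => ?c) => apply: continuous_cstf
  | |- continuous (fun x => x) => exact: continuous_idf
  | |- continuous (fun x => @?f x + @?g x) =>
      apply: (@continuous_addf _ f g); cont_auto
  | |- continuous (fun x => - @?f x) =>
      apply: (@continuous_oppf _ f); cont_auto
  | |- continuous (fun x => @?f x ^+ 2) =>
      apply: (@continuous_sqrf _ f); cont_auto
  | |- continuous (fun x => @?f x * @?g x) =>
      apply: (@continuous_mulf _ f g); cont_auto
  | |- continuous (fun x => Num.max (@?f x) (@?g x)) =>
      apply: (@continuous_maxf _ f g); cont_auto
  | |- continuous (fun x => (@?f x)^-1) =>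
      apply: (@continuous_invf _ f); [by []|cont_auto]
  | |- continuous (fun x => expR (@?f x)) =>
      apply: (@continuous_compf _ _ f (@continuous_expR _)); cont_auto
  | |- continuous (fun x => sin (@?f x)) =>
      apply: (@continuous_compf _ _ f (@continuous_sin _)); cont_auto
  | |- continuous (fun x => cos (@?f x)) =>
      apply: (@continuous_compf _ _ f (@continuous_cos _)); cont_auto
  | |- continuous (fun x => ?f x) => change (continuous f); cont_auto
  | |- continuous ?f => unfold f; cont_auto
  end.

(** * Integrals and primitives of continuous functions *)

Section integrals.
Context {R : realType}.
Implicit Types (f g : R -> R) (a b x : R).
Notation mu := (@lebesgue_measure R).

Lemma continuous_integrable f a b : continuous f ->
  mu.-integrable `[a, b] (EFin \o f).
Proof.
move=> cf; apply: continuous_compact_integrable; first exact: segment_compact.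
exact: continuous_subspaceT.
Qed.

Lemma Rintegral_FTC2 f F a b : a < b -> continuous f ->
  (forall x, a <= x <= b -> has_derivative F x (f x)) ->
  \int[mu]_(x in `[a, b]) f x = F b - F a.
Proof.
move=> ab cf Ff; rewrite /Rintegral (continuous_FTC2 ab (F := F))//.
- exact: continuous_subspaceT.
- have cF x : a <= x <= b -> {for x, continuous F}.
    by move=> /Ff; exact: has_derivative_continuous.
  split.
  + move=> x; rewrite in_itv/= => /andP[ax xb].
    by case: (Ff x _) => //; rewrite !ltW.
  + by apply: cvg_at_right_filter; apply: cF; rewrite lexx ltW.
  + by apply: cvg_at_left_filter; apply: cF; rewrite lexx ltW.
- move=> x; rewrite in_itv/= => /andP[ax xb].
  by apply: has_derivative_derive1; apply: Ff; rewrite !ltW.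
Qed.

Lemma continuous_antiderivative f : continuous f ->
  exists F, forall x, has_derivative F x (f x).
Proof.
move=> cf.
pose P a x := \int[mu]_(t in `[a, x]) f t.
have PD a x : a < x -> has_derivative (P a) x (f x).
  move=> ax; have x1 : x < x + 1 by rewrite ltrDl.
  have [dP <-] := @continuous_FTC1_closed _ f a x (x + 1) x1
    (continuous_integrable _ _ cf) ax (cf x).
  exact: derivable_has_derivative.
have PB a b x : a <= b -> b <= x -> P a x - P a b = P b x.
  move=> ab bx; rewrite /P Rintegral_itvB ?bnd_simp//; last first.
    exact: continuous_integrable.
  rewrite -Rintegral_itv_obnd_cbnd//.
  apply: integrableS (continuous_integrable b x cf) => //.
  by apply: subset_itvr; rewrite bnd_simp.
(* The base point moves with [x] so as to stay to the left of both [x] and 0. Subtracting the value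
   at 0 makes the result independent of it, and near [x] the single base point [a] can replace
   it. *)
exists (fun x => P (- (`|x| + 1)) x - P (- (`|x| + 1)) 0) => x.
pose a := - (`|x| + 2).
have ax : a < x by rewrite /a; have := ler_norm (- x); rewrite normrN; lra.
have := has_derivativeD (PD a x ax) (has_derivative_cst x (- P a 0)).
rewrite addr0; apply: has_derivative_near.
near=> y.
have yx : `|y| < `|x| + 1.
  have : `|y - x| < 1 by near: y; exact: (@cvgr_distC_lt _ _ _ _ _ id).
  by have := ler_distD 0 y x; have := ler_normB (y - x) (- x);
    rewrite opprK subrK normrN; lra.
set c := - (`|y| + 1).
have ac : a <= c by rewrite /a /c; lra.
have cy : c <= y by rewrite /c; have := ler_norm (- y); rewrite normrN; lra.
have c0 : c <= 0 by rewrite /c; have := normr_ge0 y; lra.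
by rewrite -(PB _ _ _ ac cy) -(PB _ _ _ ac c0); ring.
Unshelve. all: end_near. Qed.

End integrals.

(** * Integrals of periodic functions *)

Section shift.
Context {R : realType}.
Implicit Types (f g : R -> R) (a b c x : R).
Notation mu := (@lebesgue_measure R).

Lemma measurable_shift c :
  measurable_fun [set: measurableTypeR R]
    (fun x : measurableTypeR R => (x : R) + c : measurableTypeR R).
Proof.
by apply: continuous_measurable_fun; cont_auto.
Qed.

(** Lebesgue measure is determined by its values on half-open intervals, where the shift visibly
    preserves length. *)
Lemma lebesgue_measure_shift c (A : set R) : measurable A ->
  pushforward mu
    (fun x : measurableTypeR R => (x : R) + c : measurableTypeR R) A = mu A.
Proof.
have mc := measurable_shift c.
move=> mA; apply/esym/lebesgue_measure_unique => //= _ [[a b]] _ <-.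
rewrite /pushforward (_ : _ @^-1` _ = `]a - c, b - c]).
  by rewrite !lebesgue_measure_itv/= !lte_fin ltrD2r -!EFinB opprB addrA subrK.
by apply/seteqP; split=> x /=; rewrite !in_itv/= ltrBlDr lerBrDr.
Qed.

Lemma preimage_shift_itv c a b :
  (fun x : R => x + c) @^-1` `[a + c, b + c] = `[a, b].
Proof. by apply/seteqP; split=> x /=; rewrite !in_itv/= !lerD2r. Qed.

Lemma integrable_shift f a b c : measurable_fun [set: R] f ->
  mu.-integrable `[a, b] (EFin \o (fun x => f (x + c))) ->
  mu.-integrable `[a + c, b + c] (EFin \o f).
Proof.
move=> mf fi; have mc := measurable_shift c.
have := integrable_pushforward mc (mu := mu) (D := `[a + c, b + c])
  (f := EFin \o f).
rewrite preimage_shift_itv => /(_ _ fi (measurable_itv _)) /integrableP[].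
  exact/measurable_EFinP.
move=> _ fc; apply/integrableP; split.
  by apply/measurable_EFinP; exact: measurable_funS mf.
apply: le_lt_trans fc; rewrite le_eqVlt; apply/orP; left; apply/eqP.
by apply: eq_measure_integral => // A mA _; rewrite [RHS]lebesgue_measure_shift.
Qed.

Lemma Rintegral_shift f a b c : measurable_fun [set: R] f ->
  mu.-integrable `[a, b] (EFin \o (fun x => f (x + c))) ->
  \int[mu]_(x in `[a + c, b + c]) f x = \int[mu]_(x in `[a, b]) f (x + c).
Proof.
move=> mf fi; have mc := measurable_shift c.
have := integral_pushforward mc (mu := mu) (D := `[a + c, b + c]) (f := EFin \o f).
rewrite preimage_shift_itv => /(_ _ fi (measurable_itv _)) fE; congr fine.
apply: etrans (fE _).
  apply: eq_measure_integral => // A mA _.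
  by rewrite [RHS]lebesgue_measure_shift.
exact/measurable_EFinP.
Qed.

Lemma integrable_itv_cat f a b c : a <= b -> b <= c ->
  mu.-integrable `[a, b] (EFin \o f) -> mu.-integrable `[b, c] (EFin \o f) ->
  mu.-integrable `[a, c] (EFin \o f).
Proof.
move=> ab bc /(integrableS _ _ _) iab /integrableP[mbc ibc].
have {iab} /integrableP[mab iab] : mu.-integrable `[a, b[ (EFin \o f).
  by apply: iab => //; apply: subset_itvl; rewrite bnd_simp.
have acE : `[a, c] = `[a, b[ `|` `[b, c].
  by rewrite -itv_bndbnd_setU// bnd_simp.
have mac : measurable_fun `[a, c] (EFin \o f).
  by rewrite acE; apply/measurable_funU.
apply/integrableP; split => //; rewrite acE ge0_integral_setU//.
- exact: lte_add_pinfty.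
- by rewrite -acE; apply: measurableT_comp.
- apply/disj_setPS => x [/=]; rewrite !in_itv/= => /andP[_ xb] /andP[+ _].
  by rewrite leNgt xb.
Qed.

Lemma Rintegral_itv_cat f a b c : a <= b -> b <= c ->
  mu.-integrable `[a, c] (EFin \o f) ->
  \int[mu]_(x in `[a, c]) f x =
  \int[mu]_(x in `[a, b]) f x + \int[mu]_(x in `[b, c]) f x.
Proof.
move=> ab bc fi; apply/eqP; rewrite addrC -subr_eq; apply/eqP.
rewrite Rintegral_itvB// -Rintegral_itv_obnd_cbnd//.
by apply: integrableS fi => //; apply: subset_itvr; rewrite bnd_simp.
Qed.

End shift.

Section periodic.
Context {R : realType}.
Implicit Types (f g : R -> R) (a b c x : R).
Notation mu := (@lebesgue_measure R).

Lemma periodic_int f (z : int) x : periodic f 1 -> f (x + z%:~R) = f x.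
Proof.
move=> fp; case: z => n; first exact: periodicn.
by rewrite NegzE mulrNz -(periodicn fp n.+1 (x - _)) subrK.
Qed.

Lemma periodic_integrable f a b : periodic f 1 -> measurable_fun [set: R] f ->
  mu.-integrable `[0, 1] (EFin \o f) -> mu.-integrable `[a, b] (EFin \o f).
Proof.
move=> fp mf f01.
have fz (z : int) : mu.-integrable `[z%:~R, z%:~R + 1] (EFin \o f).
  have := @integrable_shift _ f 0 1 z%:~R mf.
  rewrite add0r (addrC 1); apply.
  by rewrite (_ : (fun x => _) = f)//; apply/funext => x; exact: periodic_int.
have fN (n : nat) : mu.-integrable `[- n%:R, n%:R] (EFin \o f).
  elim: n => [|n ih].
    by apply: integrableS f01 => //; apply: subset_itvScc; rewrite bnd_simp ?oppr0.
  have nn : (- n%:R : R) <= n%:R by rewrite (@le_trans _ _ 0)// oppr_le0.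
  have nS : (n%:R : R) <= n.+1%:R by rewrite ler_nat.
  apply: (@integrable_itv_cat _ _ _ (- n%:R)).
  - by rewrite lerN2.
  - exact: le_trans nS.
  - have := fz (- n.+1%:Z); rewrite mulrNz -pmulrn.
    by rewrite (_ : - n.+1%:R + 1 = - n%:R)// -natr1; ring.
  - apply: (integrable_itv_cat nn nS ih).
    by have := fz n%:Z; rewrite -pmulrn natr1.
pose n := (Num.truncn (`|a| + `|b|)).+1.
have nab : `|a| + `|b| < n%:R by rewrite truncnS_gt.
apply: integrableS (fN n) => // x /=; rewrite !in_itv/= => /andP[ax xb].
have := ler_norm (- a); have := ler_norm b; rewrite normrN => h1 h2.
have := normr_ge0 b; have := normr_ge0 a => h3 h4.
by apply/andP; split; lra.
Qed.

Lemma periodic_Rintegral f a : periodic f 1 -> measurable_fun [set: R] f ->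
  mu.-integrable `[0, 1] (EFin \o f) ->
  \int[mu]_(x in `[a, a + 1]) f x = \int[mu]_(x in `[0, 1]) f x.
Proof.
move=> fp mf f01.
have fi b c : mu.-integrable `[b, c] (EFin \o f) by exact: periodic_integrable.
have fs (z : int) b c : \int[mu]_(x in `[b + z%:~R, c + z%:~R]) f x =
    \int[mu]_(x in `[b, c]) f x.
  have fzE : (fun x => f (x + z%:~R)) = f.
    by apply/funext => x; exact: periodic_int.
  by rewrite Rintegral_shift ?fzE.
have /andP[] := floor_itv a; set z := Num.floor a; rewrite intrD => za az.
have az' : a <= z%:~R + 1 by exact: ltW.
(* The only integer cut needed is z + 1. The piece to its right, moved down by 1, fills [z, a] and
   completes the left piece to the unit cell [z, z + 1]. *)
rewrite (@Rintegral_itv_cat _ _ _ (z%:~R + 1))//; last by rewrite lerD2r.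
rewrite [X in _ + X](fs 1) addrC -Rintegral_itv_cat//.
by rewrite -[RHS](fs z) add0r (addrC 1).
Qed.

End periodic.

(** * Weak derivatives on the circle *)

Section L2.
Context {R : realType}.
Implicit Types (f g k : R -> R) (a b c x : R).
Notation mu := (@lebesgue_measure R).

Lemma in_C1T_has_derivative f f' : periodic f 1 ->
  (forall x, has_derivative f x (f' x)) -> continuous f' -> in_C1T f.
Proof.
move=> fp fD cf; have fE : derive1 f = f'.
  by apply/funext => x; exact: has_derivative_derive1.
by split; [exact: fp|move=> x; case: (fD x)|rewrite fE].
Qed.

Lemma in_L2T_integrable_sqr g a b : in_L2T g ->
  mu.-integrable `[a, b] (EFin \o (fun x => g x ^+ 2)).
Proof.
case=> gp mg g2; apply: periodic_integrable => //.
  by move=> x; rewrite gp.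
exact: measurable_funX.
Qed.

Lemma continuous_in_L2T k : periodic k 1 -> continuous k -> in_L2T k.
Proof.
move=> kp ck; split=> //; first exact: continuous_measurable_fun.
exact/continuous_integrable/continuous_sqrf.
Qed.

(** The product is dominated pointwise by f^2 + g^2. *)
Lemma integrable_mul_sqr f g (D : set (measurableTypeR R)) :
  measurable D -> measurable_fun [set: R] f -> measurable_fun [set: R] g ->
  mu.-integrable D (EFin \o (fun x => f x ^+ 2)) ->
  mu.-integrable D (EFin \o (fun x => g x ^+ 2)) ->
  mu.-integrable D (EFin \o (fun x => f x * g x)).
Proof.
move=> mD mf mg f2 g2; apply: (le_integrable _ _ _ (integrableD _ f2 g2)) => //.
- by apply/measurable_EFinP; apply: measurable_funTS; apply: measurable_funM.
- move=> x _ /=; rewrite lee_fin ler_norml.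
  rewrite (ger0_norm (_ : 0 <= f x ^+ 2 + g x ^+ 2)) ?addr_ge0 ?sqr_ge0//.
  have := sqr_ge0 (f x - g x); have := sqr_ge0 (f x + g x).
  have := sqr_ge0 (f x); have := sqr_ge0 (g x).
  by rewrite !expr2 => *; apply/andP; split; nra.
Qed.

Lemma in_L2T_integrable_mul g k a b : in_L2T g -> in_L2T k ->
  mu.-integrable `[a, b] (EFin \o (fun x => g x * k x)).
Proof.
move=> g2 k2; have [_ mg _] := g2; have [_ mk _] := k2.
by apply: integrable_mul_sqr => //; exact: in_L2T_integrable_sqr.
Qed.

Lemma in_L2T_integrable_mul_continuous g k a b : in_L2T g -> continuous k ->
  mu.-integrable `[a, b] (EFin \o (fun x => g x * k x)).
Proof.
move=> g2 ck; have [_ mg _] := g2; apply: integrable_mul_sqr => //.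
- exact: continuous_measurable_fun.
- exact: in_L2T_integrable_sqr.
- exact/continuous_integrable/continuous_sqrf.
Qed.

Lemma in_L2T_integrable g a b : in_L2T g -> mu.-integrable `[a, b] (EFin \o g).
Proof.
have c1 : in_L2T (fun _ : R => 1 : R).
  by apply: continuous_in_L2T => // x; exact: cvg_cst.
move=> g2; have := in_L2T_integrable_mul a b g2 c1.
by rewrite (_ : (fun x => g x * 1) = g)//; apply/funext => x; rewrite mulr1.
Qed.

Lemma in_L2TN g : in_L2T g -> in_L2T (fun x => - g x).
Proof.
move=> g2; have [gp mg _] := g2; split.
- by move=> x; rewrite gp.
- exact: measurableT_comp.
- have := in_L2T_integrable_sqr 0 1 g2.
  by under [X in _ -> _.-integrable _ X]eq_fun do rewrite sqrrN.
Qed.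

Lemma in_L2TD g k : in_L2T g -> in_L2T k -> in_L2T (fun x => g x + k x).
Proof.
move=> g2 k2; have [gp mg _] := g2; have [kp mk _] := k2; split.
- by move=> x; rewrite gp kp.
- exact: measurable_funD.
- have i1 := in_L2T_integrable_sqr 0 1 g2.
  have i2 := in_L2T_integrable_mul 0 1 g2 k2.
  have i3 := in_L2T_integrable_sqr 0 1 k2.
  have mI : measurable (`[0%R, 1%R] : set (measurableTypeR R)) by [].
  apply: (eq_integrable mI _ _ _ (integrableD mI (integrableD mI i1
    (integrableD mI i2 i2)) i3)) => x _ /=.
  by rewrite -!EFinD; congr EFin; ring.
Qed.

Lemma in_C1T_in_L2T f : in_C1T f -> in_L2T f.
Proof.
case=> fp fd _; apply: continuous_in_L2T => // x.
exact: has_derivative_continuous (derivable_has_derivative (fd x)).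
Qed.

End L2.

(** * Smooth periodic approximations of the indicator of an arc *)

Section indicator_approximation.
Context {R : realType}.
Implicit Types (f g : R -> R) (a b c x y : R).
Notation mu := (@lebesgue_measure R).

(** Squaring removes the kink of the positive part at 0; this is the reason for the square in the
    bump below. At 0 the difference quotient is the positive part itself, which is continuous. *)
Lemma has_derivative_sqr_max0 x :
  has_derivative (fun z => Num.max z 0 ^+ 2) x (2 * Num.max x 0).
Proof.
have [x0|x0|->] := ltgtP x 0.
- rewrite mulr0.
  apply: has_derivative_near (has_derivative_cst x 0); near=> y.
  by rewrite max_r ?expr0n//= ltW//; near: y; exact: lt_nbhsl.
- have := has_derivative_sqr (has_derivative_id x); rewrite mulr1.
  apply: has_derivative_near; near=> y.
  by rewrite max_l// ltW//; near: y; exact: lt_nbhsr.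
- rewrite ?maxxx mulr0; apply/is_derive1_caratheodory.
  exists (fun z => Num.max z 0); split; last by rewrite maxxx.
  + move=> z; rewrite maxxx expr0n subr0/= subr0.
    by have [z0|z0] := leP z 0; rewrite ?mulr0 ?mul0r ?expr0n.
  + apply: continuous_max; [exact: cvg_id|exact: cvg_cst].
Unshelve. all: end_near. Qed.

(* The product of sines is nonpositive off [a, b] modulo 1, so truncating it
   gives a periodic bump without any gluing. *)
Definition sin_bump a b y : R :=
  Num.max (sin (pi * (y - a)) * sin (pi * (b - y))) 0 ^+ 2.

(** With q the bump, n q / (1 + n q) stays in [0, 1], is 0 where q = 0 and tends to 1 where q > 0.
    It is C^1 because q is, and the denominator is at least 1. *)
Definition approx_indic a b (n : nat) y : R :=
  n%:R * sin_bump a b y / (1 + n%:R * sin_bump a b y).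

Lemma sin_bump_ge0 a b y : 0 <= sin_bump a b y.
Proof. exact: sqr_ge0. Qed.

Lemma sin_bump_periodic a b : periodic (sin_bump a b) 1.
Proof.
move=> y; rewrite /sin_bump.
have -> : pi * (y + 1 - a) = pi * (y - a) + pi by ring.
have -> : pi * (b - (y + 1)) = pi * (b - y) - pi by ring.
by rewrite -{2}(subrK pi (pi * (b - y))) !sinDpi mulrN mulNr.
Qed.

Lemma sin_pi_ge0 x : 0 <= x <= 1 -> 0 <= sin (pi * x).
Proof.
move=> /andP[x0 x1]; have pi0 := pi_gt0 R; apply: sin_ge0_pi.
by apply/andP; split; nra.
Qed.

Lemma sin_pi_gt0 x : 0 < x < 1 -> 0 < sin (pi * x).
Proof.
move=> /andP[x0 x1]; have pi0 := pi_gt0 R; apply: sin_gt0_pi.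
by apply/andP; split; nra.
Qed.

Lemma sin_bump_gt0 a b y : b < a + 1 -> a < y < b -> 0 < sin_bump a b y.
Proof.
move=> ba /andP[ay yb]; rewrite exprn_gt0// lt_max mulr_gt0//.
  by apply: sin_pi_gt0; apply/andP; split; lra.
by apply: sin_pi_gt0; apply/andP; split; lra.
Qed.

Lemma sin_bump_eq0 a b y : a < b -> a <= y <= a + 1 -> ~~ (a < y < b) ->
  sin_bump a b y = 0.
Proof.
move=> ab /andP[ay ya] yab.
have [->|ay'] := eqVneq y a.
  by rewrite /sin_bump subrr mulr0 sin0 mul0r maxxx expr0n.
have {ay'}ay : a < y by rewrite lt_neqAle eq_sym ay'.
move: yab; rewrite ay/= -leNgt => yb.
rewrite /sin_bump max_r ?expr0n// mulr_ge0_le0//.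
  by apply: sin_pi_ge0; apply/andP; split; lra.
rewrite -[b - y]opprB mulrN sinN oppr_le0.
by apply: sin_pi_ge0; apply/andP; split; lra.
Qed.

Lemma in_C1T_approx_indic a b n : in_C1T (approx_indic a b n).
Proof.
pose w y := sin (pi * (y - a)) * sin (pi * (b - y)).
pose w' y := cos (pi * (y - a)) * pi * sin (pi * (b - y))
  - sin (pi * (y - a)) * cos (pi * (b - y)) * pi.
have wD y : has_derivative w y (w' y).
  by apply: has_derivative_eq; [derive_auto|rewrite /w'; ring].
have qD y : has_derivative (sin_bump a b) y (2 * Num.max (w y) 0 * w' y).
  exact: has_derivative_comp (has_derivative_sqr_max0 (w y)) (wD y).
have nq y : 1 + n%:R * sin_bump a b y != 0.
  by rewrite gt_eqF// ltr_pwDl// mulr_ge0// sin_bump_ge0.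
apply: (@in_C1T_has_derivative _ _ (fun y => n%:R * (2 * Num.max (w y) 0 * w' y)
    / (1 + n%:R * sin_bump a b y) ^+ 2)).
- by move=> y; rewrite /approx_indic sin_bump_periodic.
- move=> y; have := has_derivativeM
    (has_derivativeM (has_derivative_cst y n%:R) (qD y))
    (@has_derivativeV _ (fun y => 1 + n%:R * sin_bump a b y) y _ (nq y)
      (has_derivativeD (has_derivative_cst y 1)
      (has_derivativeM (has_derivative_cst y n%:R) (qD y)))).
  move=> /has_derivative_eq; apply; have := nq y; set q := sin_bump _ _ _ => q0.
  by field.
- have cq : continuous (sin_bump a b).
    by move=> y; exact: has_derivative_continuous (qD y).
  have nq2 y : (1 + n%:R * sin_bump a b y) ^+ 2 != 0 by rewrite expf_neq0.
  rewrite /w' /w; cont_auto.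
Qed.

End indicator_approximation.

Section weak_derivative_unique.
Context {R : realType}.
Implicit Types (f g d : R -> R) (a b c x : R).
Notation mu := (@lebesgue_measure R).

Lemma approx_indic_ge0 a b n x : 0 <= approx_indic a b n x.
Proof.
by rewrite divr_ge0 ?addr_ge0 ?mulr_ge0 ?sin_bump_ge0// ler0n.
Qed.

Lemma approx_indic_le1 a b n x : approx_indic a b n x <= 1.
Proof.
have q0 : 0 <= n%:R * sin_bump a b x by rewrite mulr_ge0// sin_bump_ge0.
by rewrite ler_pdivrMr ?mul1r ?ltr_pwDl// lerDr.
Qed.

Lemma cvg_approx_indic a b x : b < a + 1 -> a < x < b ->
  approx_indic a b n x @[n --> \oo] --> (1 : R).
Proof.
move=> ba xab; have := sin_bump_gt0 ba xab; rewrite /approx_indic.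
set q := sin_bump _ _ _ => q0; apply/cvgrPdist_lt => e e0; near=> n.
have nq : (e * q)^-1 < n%:R by near: n; exact: nbhs_infty_gtr.
have n0 : 0 < 1 + n%:R * q by rewrite ltr_pwDl// mulr_ge0// ltW.
rewrite -{1}(divff (lt0r_neq0 n0)) -mulrBl addrK mul1r.
rewrite gtr0_norm ?invr_gt0// invf_plt ?posrE//.
rewrite ltr_pwDl//; move: nq; rewrite invfM -ltr_pdivlMr ?invr_gt0//.
by rewrite invrK => /ltW.
Unshelve. all: end_near. Qed.

(** Test with [approx_indic a b n] and let n grow, by dominated convergence with majorant |d|. The
    test integral is first moved to the period [a, a + 1], on which the bump vanishes off ]a, b[. *)
Lemma in_L2T_orthogonal_Rintegral0 d a b : in_L2T d ->
  (forall eta, in_C1T eta -> \int[mu]_(x in `[0, 1]) (d x * eta x) = 0) ->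
  a < b -> b < a + 1 -> \int[mu]_(x in `[a, b]) d x = 0.
Proof.
move=> d2 dort ab ba.
have md : measurable_fun [set: R] d by case: d2.
have eta2 n := in_C1T_in_L2T (in_C1T_approx_indic a b n).
have mf n : measurable_fun [set: R] (fun x => d x * approx_indic a b n x).
  by apply: measurable_funM => //; case: (eta2 n).
have D0 n : \int[mu]_(x in `[a, a + 1]) (d x * approx_indic a b n x) = 0.
  rewrite periodic_Rintegral//; first exact/dort/in_C1T_approx_indic.
    move=> x; have [-> _ _] := in_C1T_approx_indic a b n.
    by case: d2 => ->.
  exact: in_L2T_integrable_mul.
have id := in_L2T_integrable a (a + 1) d2.
pose f_ (n : nat) (x : measurableTypeR R) := (d x * approx_indic a b n x)%:E.
pose f (x : measurableTypeR R) := ((d \_ `]a, b[) x)%:E.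
have mI : measurable (`[a, a + 1] : set (measurableTypeR R)) by [].
have [||||_ _ fcvg] := @dominated_convergence _ _ _ mu _ mI f_ f
  (abse \o (EFin \o d)) _ _ _ (integrable_abse id).
- by move=> n; apply/measurable_EFinP/measurable_funTS; exact: mf.
- apply/measurable_EFinP; apply: measurable_funTS.
  by apply/(measurable_restrictT _ _).1 => //; exact: measurable_funTS.
- apply: aeW => x /=; rewrite in_itv/= => xI; apply: cvg_EFin.
    by apply: nearW.
  rewrite /f_ /f /= patchE; have [xab|xab] := boolP (a < x < b).
    rewrite mem_set/= ?in_itv//= -[X in _ --> X]mulr1.
    by apply: cvgM; [exact: cvg_cst|exact: cvg_approx_indic].
  rewrite memNset/= ?in_itv//=; last exact/negP.
  rewrite /approx_indic sin_bump_eq0//.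
  rewrite (_ : (fun=> _) = fun=> 0); first exact: cvg_cst.
  by apply/funext => n; rewrite mulr0 mul0r mulr0.
- apply: aeW => x n _ /=; rewrite lee_fin normrM ler_piMr//.
  by rewrite ger0_norm ?approx_indic_ge0// approx_indic_le1.
have -> : \int[mu]_(x in `[a, b]) d x =
    \int[mu]_(x in `[a, a + 1]) (d \_ `]a, b[) x.
  rewrite -Rintegral_mkcondr setIidr; last first.
    move=> x /=; rewrite !in_itv/= => /andP[ax xb].
    by apply/andP; split; lra.
  have iab := in_L2T_integrable a b d2.
  have sub (i j : bool) : [set` Interval (BSide i a) (BSide j b)] `<=` `[a, b].
    move=> x; case: i; case: j; rewrite /= !in_itv/= => /andP[ax xb];
      by apply/andP; split; lra.
  rewrite Rintegral_itv_bndo_bndc; last first.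
    by apply: integrableS iab => //; exact: (sub false true).
  rewrite Rintegral_itv_obnd_cbnd//.
  by apply: integrableS iab => //; exact: (sub false false).
rewrite /Rintegral.
have f0 n : (\int[mu]_(x in `[a, (a + 1)%R]) f_ n x = 0)%E.
  rewrite -[LHS]fineK; last exact/integrable_fin_num/in_L2T_integrable_mul.
  by congr EFin; exact: D0.
suff -> : (\int[mu]_(x in `[a, (a + 1)%R]) f x = 0)%E by [].
apply: (cvg_unique _ fcvg) => //.
rewrite (_ : [sequence _]_n = fun=> 0%E); first exact: cvg_cst.
by apply/funext => n; exact: f0.
Qed.

(** The primitive of d from a vanishes identically on ]a, b[, and by Lebesgue differentiation its
    derivative is d almost everywhere. *)
Lemma in_L2T_orthogonal_ae0 d a b : in_L2T d ->
  (forall eta, in_C1T eta -> \int[mu]_(x in `[0, 1]) (d x * eta x) = 0) ->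
  a < b -> b < a + 1 -> {ae mu, forall x, a < x < b -> d x = 0}.
Proof.
move=> d2 dort ab ba; pose f := d \_ `[a, b].
have iT : mu.-integrable [set: R] (EFin \o f).
  rewrite /f -restrict_EFin; apply/integrable_restrict => //=.
  by rewrite setTI; exact: in_L2T_integrable.
have fi y : mu.-integrable [set` Interval (BLeft a) (BRight y)] (EFin \o f).
  exact: integrableS iT.
have lf : locally_integrable [set: R] f.
  by apply: integrable_locally => //; exact: in_L2T_integrable.
move: (FTC1 fi lf); apply: filterS; first exact: (ae_filter_ringOfSetsType mu).
move=> x xF /andP[ax xb].
have [|_ ] := xF; first by rewrite lte_fin.
rewrite {2}/f patchE mem_set/= ?in_itv/= ?(ltW ax) ?(ltW xb)// => <-.
apply: has_derivative_derive1.
apply: has_derivative_near (has_derivative_cst x 0).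
near=> y.
have ay : a < y by near: y; exact: lt_nbhsr.
have yb : y < b by near: y; exact: lt_nbhsl.
rewrite -(@in_L2T_orthogonal_Rintegral0 d a y)//; last exact: lt_trans ba.
apply: eq_Rintegral => z; rewrite inE/= in_itv/= => /andP[az zy].
by rewrite /f patchE mem_set//= in_itv/= az (le_trans zy) ?ltW.
Unshelve. all: end_near. Qed.

Lemma weak_derivative_unique f g1 g2 a b : in_L2T g1 -> in_L2T g2 ->
  is_weak_derivative f g1 -> is_weak_derivative f g2 -> a < b -> b < a + 1 ->
  {ae mu, forall x, a <= x <= b -> g1 x = g2 x}.
Proof.
move=> g12 g22 fg1 fg2 ab ba.
(* The closed segment is enlarged by a third of the gap on each side: its endpoints become interior
   and the total length stays below 1. *)
pose e := (a + 1 - b) / 3.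
have d2 : in_L2T (fun x => g1 x + - g2 x) by apply: in_L2TD => //; exact: in_L2TN.
have dort eta : in_C1T eta ->
    \int[mu]_(x in `[0, 1]) ((g1 x + - g2 x) * eta x) = 0.
  move=> eta1; have eta2 := in_C1T_in_L2T eta1.
  under eq_Rintegral do rewrite mulrDl mulNr.
  rewrite RintegralB//; [|exact: in_L2T_integrable_mul..].
  by apply/eqP; rewrite subr_eq0 -eqr_opp -fg1// fg2.
have eab : a - e < b + e by rewrite /e; lra.
have eba : b + e < a - e + 1 by rewrite /e; lra.
have := in_L2T_orthogonal_ae0 d2 dort eab eba.
apply: filterS; first exact: (ae_filter_ringOfSetsType mu).
move=> x gx /andP[ax xb].
by apply/eqP; rewrite -subr_eq0 gx//; apply/andP; split; rewrite /e; lra.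
Qed.

Lemma weak_derivativeP f : in_H1T f ->
  in_L2T (weak_derivative f) /\ is_weak_derivative f (weak_derivative f).
Proof.
case=> _ [g g2 fg]; rewrite /weak_derivative.
by case: xgetP => [h _ []//|/(_ g)[]].
Qed.

End weak_derivative_unique.

(** * Periodic extension of functions supported in less than one period *)

Definition vanishes_outside (R : realType) (a b : R) (f : R -> R) : Prop :=
  forall x, ~~ (a < x < b) -> f x = 0.

(** The integer shift brings [x] into [a, a + 1[. *)
Definition periodic_ext (R : realType) (a : R) (f : R -> R) (x : R) : R :=
  f (x - (Num.floor (x - a))%:~R).

Section periodic_extension.
Context {R : realType}.
Implicit Types (f g : R -> R) (a b x : R).
Notation mu := (@lebesgue_measure R).

Lemma periodic_ext_periodic a f : periodic (periodic_ext a f) 1.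
Proof.
move=> x; rewrite /periodic_ext.
have -> : Num.floor (x + 1 - a) = Num.floor (x - a) + 1.
  have /andP[] := floor_itv (x - a); rewrite intrD => kx xk.
  by apply: floor_def; rewrite !intrD; apply/andP; split; lra.
by congr f; rewrite intrD; ring.
Qed.

(** The integer may differ from the floor: if it does, both shifted points fall outside ]a, b[ and
    both values are 0. The allowed range [b - 1, a + 1] is longer than a period, which gives room
    for neighbourhoods. *)
Lemma periodic_ext_shift a b f x (z : int) : vanishes_outside a b f ->
  b - 1 <= x - z%:~R <= a + 1 -> b < a + 1 -> periodic_ext a f x = f (x - z%:~R).
Proof.
move=> f0 /andP[xb xa] ba; rewrite /periodic_ext.
have /andP[] := floor_itv (x - a); set k := Num.floor _ => ka; rewrite intrD => ak.
have [zk|zk|->//] := ltgtP k z.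
- have : (k + 1 <= z)%R by rewrite lezD1.
  rewrite -(ler_int R) intrD => kz.
  by rewrite !f0 ?negb_and -?leNgt//; apply/orP; [left|right]; lra.
- have : (z + 1 <= k)%R by rewrite lezD1.
  rewrite -(ler_int R) intrD => kz.
  by rewrite !f0 ?negb_and -?leNgt//; apply/orP; [right|left]; lra.
Qed.

Lemma periodic_ext_id a b f x : vanishes_outside a b f -> b < a + 1 ->
  b - 1 <= x <= a + 1 -> periodic_ext a f x = f x.
Proof.
move=> f0 ba xab; have := @periodic_ext_shift a b f x 0 f0.
by rewrite subr0; exact.
Qed.

(** A single z serves every f, so that a function and its derivative are unwrapped by the same
    shift. The number m lies midway between b - 1 and a, hence [m, m + 1] is strictly inside ]b - 1,
    a + 1[. *)
Lemma periodic_ext_near a b x : b < a + 1 -> exists z : int,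
  forall f, vanishes_outside a b f ->
  \near x, f (x - z%:~R) = periodic_ext a f x.
Proof.
move=> ba; pose m := (a + b - 1) / 2.
exists (Num.floor (x - m)) => f f0.
have /andP[] := floor_itv (x - m); set z := Num.floor _.
rewrite intrD => zm mz; near=> y.
rewrite (@periodic_ext_shift a b f y z f0)//; apply/andP; split.
  rewrite lerBrDr; apply: ltW; near: y; apply: lt_nbhsr; rewrite /m in zm; lra.
rewrite lerBlDr; apply: ltW; near: y; apply: lt_nbhsl; rewrite /m in mz; lra.
Unshelve. all: end_near. Qed.

Lemma has_derivative_periodic_ext a b f f' x : b < a + 1 ->
  vanishes_outside a b f -> vanishes_outside a b f' ->
  (forall y, has_derivative f y (f' y)) ->
  has_derivative (periodic_ext a f) x (periodic_ext a f' x).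
Proof.
move=> ba f0 f'0 fD; have [z fz] := periodic_ext_near x ba.
apply: has_derivative_near (fz _ f0) _.
rewrite -(nbhs_singleton (fz _ f'0)) -[X in has_derivative _ _ X]mulr1.
apply: has_derivative_comp; first exact: fD.
apply: has_derivative_eq (addr0 1).
by apply: has_derivativeD; derive_auto.
Qed.

Lemma continuous_periodic_ext a b f : b < a + 1 ->
  vanishes_outside a b f -> continuous f -> continuous (periodic_ext a f).
Proof.
move=> ba f0 cf x; have [z fz] := periodic_ext_near x ba.
rewrite /continuous_at -(nbhs_singleton (fz _ f0)).
apply: cvg_trans (near_eq_cvg (fz _ f0)) _.
by apply: continuous_compf => //; cont_auto.
Qed.

Lemma Rintegral_periodic_ext a b f g : a < b -> b < a + 1 ->
  vanishes_outside a b f -> continuous f -> in_L2T g ->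
  \int[mu]_(x in `[0, 1]) (g x * periodic_ext a f x) =
  \int[mu]_(x in `[a, b]) (g x * f x).
Proof.
move=> ab ba f0 cf g2.
have ext2 : in_L2T (periodic_ext a f).
  apply: continuous_in_L2T; first exact: periodic_ext_periodic.
  exact: continuous_periodic_ext f0 cf.
rewrite -(@periodic_Rintegral _ _ a); first last.
- exact: in_L2T_integrable_mul.
- by apply: measurable_funM; [case: g2|case: ext2].
- by move=> x; rewrite periodic_ext_periodic; case: g2 => ->.
rewrite (Rintegral_itv_cat (ltW ab) (ltW ba)); last exact: in_L2T_integrable_mul.
rewrite [X in _ + X](_ : _ = 0) ?addr0.
  apply: eq_Rintegral => x; rewrite inE/= in_itv/= => /andP[ax xb].
  by rewrite (periodic_ext_id f0)//; apply/andP; split; lra.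
transitivity (\int[mu]_(x in `[b, a + 1]) (0 : R)); last first.
  by rewrite Rintegral_cst// mul0r.
apply: eq_Rintegral => x; rewrite inE/= in_itv/= => /andP[bx xa].
rewrite (periodic_ext_id f0)// ?f0 ?mulr0//.
  by rewrite negb_and -!leNgt bx orbT.
by apply/andP; split; lra.
Qed.

End periodic_extension.

(** * First variation *)

Section variations.
Context {R : realType}.
Implicit Types (f g l eta zeta phi : R -> R) (a b x : R).
Notation mu := (@lebesgue_measure R).

Lemma vanishes_outside_antiderivative F f a b : vanishes_outside a b f ->
  (forall x, has_derivative F x (f x)) -> F a = 0 -> F b = 0 ->
  vanishes_outside a b F.
Proof.
move=> f0 FD Fa Fb x; rewrite negb_and -!leNgt => /orP[xa|bx].
  rewrite -Fa; apply/esym/(has_derivative0_segment xa) => y /andP[_ ya].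
  by rewrite -(f0 y)// negb_and -!leNgt ya.
rewrite -Fb; apply: (has_derivative0_segment bx) => y /andP[yb _].
by rewrite -(f0 y)// negb_and -!leNgt yb orbT.
Qed.

Lemma vanishes_outside_bounded f a b : a <= b -> vanishes_outside a b f ->
  continuous f -> exists2 M, 0 < M & forall x, `|f x| <= M.
Proof.
move=> ab f0 cf.
have cn : continuous (fun x => `|f x|).
  by move=> x; apply: cvg_norm; exact: cf.
have [c _ fc] := EVT_max ab (continuous_subspaceT cn).
exists (`|f c| + 1); first by rewrite ltr_wpDl.
move=> x; have [/andP[ax xb]|/f0 ->] := boolP (a < x < b).
  by rewrite ler_wpDr// fc// in_itv/= !ltW.
by rewrite normr0 addr_ge0.
Qed.

Lemma derive1_periodic f c : (forall x, derivable f x 1) ->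
  (forall x, f (x + 1) = f x + c) -> periodic (derive1 f) 1.
Proof.
move=> fd fc x; have fD y := derivable_has_derivative (fd y).
have h1 : has_derivative (fun y => f (y + 1)) x (derive1 f (x + 1) * (1 + 0)).
  by apply: (@has_derivative_comp _ (fun y => y + 1)); [exact: fD|derive_auto].
have h2 : has_derivative (fun y => f y + c) x (derive1 f x + 0).
  by derive_auto.
move/has_derivative_derive1: h1; move/has_derivative_derive1: h2.
rewrite !addr0 mulr1 => <- <-.
by congr (derive1 _ x); apply/funext => y; rewrite fc.
Qed.

(** For the C^1 summand l, integration by parts over one period has cancelling boundary terms, since
    l and the test function are both periodic. *)
Lemma is_weak_derivativeD f g l l' : in_L2T f -> in_L2T g ->
  is_weak_derivative f g -> periodic l 1 ->
  (forall x, has_derivative l x (l' x)) -> periodic l' 1 -> continuous l' ->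
  is_weak_derivative (fun x => f x + l x) (fun x => g x + l' x).
Proof.
move=> f2 g2 fg lp lD l'p cl' eta eta1.
have eta2 := in_C1T_in_L2T eta1; have [etap etaD ceta'] := eta1.
have etaD' x : has_derivative eta x (derive1 eta x).
  exact: derivable_has_derivative.
have eta'p : periodic (derive1 eta) 1.
  by apply: (@derive1_periodic eta 0 etaD) => x; rewrite etap addr0.
have eta'2 := continuous_in_L2T eta'p ceta'.
have cl : continuous l by move=> x; exact: has_derivative_continuous (lD x).
have l2 := continuous_in_L2T lp cl; have l'2 := continuous_in_L2T l'p cl'.
have ceta : continuous eta by move=> x; exact: has_derivative_continuous (etaD' x).
under eq_Rintegral do rewrite mulrDl.
under [in RHS]eq_Rintegral do rewrite mulrDl.
rewrite !RintegralD//; [|exact: in_L2T_integrable_mul..].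
rewrite opprD fg//; congr (_ + _).
apply/eqP; rewrite -addr_eq0 -RintegralD//; [|exact: in_L2T_integrable_mul..].
rewrite (@Rintegral_FTC2 _ _ (fun x => l x * eta x))//.
- by rewrite -[1]add0r lp etap subrr.
- by cont_auto.
- by move=> x _; apply: has_derivative_eq; [derive_auto|rewrite addrC].
Qed.

Lemma HT_derive1_periodic phi : HT phi -> periodic (derive1 phi) 1.
Proof. by case=> -[phid _ phi1 _] _; exact: derive1_periodic phi1. Qed.

Lemma HT_in_L2T_derive1 phi : HT phi -> in_L2T (derive1 phi).
Proof.
move=> phiH; have [[_ cphi _ _] _] := phiH.
exact/continuous_in_L2T/cphi/HT_derive1_periodic.
Qed.

Lemma HT_continuous_log_deriv phi : HT phi -> continuous (log_deriv phi).
Proof.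
case=> -[_ cphi _ phi0] _ x; apply: continuous_comp; first exact: cphi.
exact: continuous_ln.
Qed.

(** The weak derivative of u + ln (1 + eps z) when [g] is that of u and [z'] is the derivative of
    [z]. *)
Definition var_deriv (g z z' : R -> R) (eps : R) (x : R) : R :=
  g x + eps * z' x / (1 + eps * z x).

Lemma variation_log_deriv phi z z' theta eps : HT phi ->
  periodic z 1 -> periodic z' 1 -> (forall x, has_derivative z x (z' x)) ->
  continuous z' -> periodic theta 1 ->
  (forall x, has_derivative theta x (derive1 phi x * z x)) ->
  (forall x, 0 < 1 + eps * z x) ->
  let psi := fun x => phi x + eps * theta x in
  [/\ HT psi, forall x, derive1 psi x = derive1 phi x * (1 + eps * z x),
      in_L2T (var_deriv (weak_derivative (log_deriv phi)) z z' eps) &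
      is_weak_derivative (log_deriv psi)
        (var_deriv (weak_derivative (log_deriv phi)) z z' eps)].
Proof.
move=> phiH zp z'p zD cz' thp thD z0 psi; have [[phid cphi phi1 phi0] uH] := phiH.
have phi'p := HT_derive1_periodic phiH.
have phiD x := derivable_has_derivative (phid x).
have psiD x : has_derivative psi x (derive1 phi x * (1 + eps * z x)).
  by apply: has_derivative_eq; [derive_auto|rewrite /=; ring].
have psi'E x : derive1 psi x = derive1 phi x * (1 + eps * z x).
  exact: has_derivative_derive1.
have cz : continuous z by move=> x; exact: has_derivative_continuous (zD x).
have z0' x : 1 + eps * z x != 0 by rewrite lt0r_neq0.
pose l x := ln (1 + eps * z x).
have lD x : has_derivative l x (eps * z' x / (1 + eps * z x)).
  apply: has_derivative_eq; first apply: has_derivative_ln => //.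
    by derive_auto.
  by rewrite mul0r !add0r mulrC.
have logE : log_deriv psi = fun x => log_deriv phi x + l x.
  apply/funext => x; rewrite /log_deriv psi'E lnM ?posrE//; exact: phi0.
have [g2 gw] := weak_derivativeP uH; have [u2 _] := uH.
have lp : periodic l 1 by move=> x; rewrite /l zp.
have l'p : periodic (fun x => eps * z' x / (1 + eps * z x)) 1.
  by move=> x; rewrite zp z'p.
have cl' : continuous (fun x => eps * z' x / (1 + eps * z x)) by cont_auto.
have var2 : in_L2T (var_deriv (weak_derivative (log_deriv phi)) z z' eps).
  by apply: in_L2TD => //; exact: continuous_in_L2T.
have varw : is_weak_derivative (log_deriv psi)
    (var_deriv (weak_derivative (log_deriv phi)) z z' eps).
  by rewrite logE; exact: is_weak_derivativeD.
have psiDiff : Diff1 psi.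
  split.
  - by move=> x; exact: has_derivative_derivable (psiD x).
  - rewrite (_ : derive1 psi = fun x => derive1 phi x * (1 + eps * z x)).
      by cont_auto.
    exact/funext.
  - by move=> x; rewrite /psi phi1 thp; ring.
  - by move=> x; rewrite psi'E mulr_gt0//; exact: phi0.
have psiL2 : in_L2T (log_deriv psi).
  rewrite logE; apply: in_L2TD => //; apply: continuous_in_L2T => // x.
  exact: has_derivative_continuous (lD x).
split; [split; first exact: psiDiff|exact: psi'E|exact: var2|exact: varw].
split; first exact: psiL2.
by exists (var_deriv (weak_derivative (log_deriv phi)) z z' eps).
Qed.

(** Frees [action] from the representative chosen by [weak_derivative]: two weak derivatives agree
    almost everywhere on [a, b], so the integral is the same. For a perturbed map this allows the
    explicit [var_deriv]. *)
Lemma actionE a b phi g : a < b -> b < a + 1 -> in_L2T g -> HT phi ->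
  is_weak_derivative (log_deriv phi) g ->
  action a b phi = 2^-1 * \int[mu]_(x in `[a, b])
    (g x ^+ 2 - 4 * pi ^+ 2 * derive1 phi x ^+ 2).
Proof.
move=> ab ba g2 phiH gw; have [_ uH] := phiH.
have [h2 hw] := weak_derivativeP uH; have phi'2 := HT_in_L2T_derive1 phiH.
have mphi : measurable_fun [set: R] (derive1 phi) by case: phi'2.
rewrite /action; congr (_ * fine _); apply: ae_eq_integral => //.
- apply/measurable_EFinP/measurable_funTS; apply: measurable_funB.
    by apply: measurable_funX; case: h2.
  by apply: measurable_funM => //; exact: measurable_funX.
- apply/measurable_EFinP/measurable_funTS; apply: measurable_funB.
    by apply: measurable_funX; case: g2.
  by apply: measurable_funM => //; exact: measurable_funX.
- have := weak_derivative_unique h2 g2 hw gw ab ba.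
  apply: filterS; first exact: (ae_filter_ringOfSetsType mu).
  by move=> x hg; rewrite /= in_itv/= => xab; rewrite hg.
Qed.

(** A Taylor bound in eps. The second-order part of the phi'^2 term is nonpositive and is dropped.
    With K = (eps M)^2, the cross term costs 2 K (1 + g^2) and the square of the correction 4 K,
    whence the 6; both use 1 / (1 + eps z) <= 2. *)
Lemma var_deriv_bound (g z z' phi' M eps : R) : `|z| <= M -> `|z'| <= M ->
  `|eps| * M <= 2^-1 ->
  (g + eps * z' / (1 + eps * z)) ^+ 2 -
    4 * pi ^+ 2 * (phi' * (1 + eps * z)) ^+ 2 <=
  g ^+ 2 - 4 * pi ^+ 2 * phi' ^+ 2 +
  2 * eps * (g * z' - 4 * pi ^+ 2 * phi' ^+ 2 * z) +
  6 * (eps * M) ^+ 2 * (1 + g ^+ 2).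
Proof.
move=> zM z'M eM.
have M0 : 0 <= M by apply: le_trans zM.
have sM : `|eps * z| <= 2^-1.
  by rewrite normrM (le_trans _ eM)// ler_wpM2l.
have s'M : `|eps * z'| <= `|eps * M|.
  by rewrite !normrM ler_wpM2l// (ger0_norm M0).
have {}zM : `|eps * z| <= `|eps * M|.
  by rewrite !normrM ler_wpM2l// (ger0_norm M0).
move: sM; rewrite ler_norml => /andP[s1 s2].
set s := eps * z in zM s1 s2 *; set t := eps * z' in s'M *.
have r0 : 0 < (1 + s)^-1 by rewrite invr_gt0; lra.
have r2 : (1 + s)^-1 <= 2.
  by rewrite invf_ple ?posrE//; lra.
(* Separates the exact linear term 2 g t from a remainder carrying the factor s t, which is
   quadratic in eps. *)
have rs : (1 + s)^-1 = 1 - s * (1 + s)^-1 by field; lra.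
set r := (1 + s)^-1 in r0 r2 rs *.
have st : `|s * t| <= (eps * M) ^+ 2.
  by rewrite normrM -real_normK ?num_real// expr2 ler_pM.
have tt : t ^+ 2 <= (eps * M) ^+ 2.
  by rewrite -(real_normK (num_real t)) -(real_normK (num_real (eps * M)))
    lerXn2r ?nnegrE.
set K := (eps * M) ^+ 2 in st tt *.
have K0 : 0 <= K by exact: sqr_ge0.
have -> : 2 * eps * (g * z' - 4 * pi ^+ 2 * phi' ^+ 2 * z) =
    2 * (g * t) - 8 * pi ^+ 2 * phi' ^+ 2 * s by rewrite /s /t; ring.
have e1 : (g + t * r) ^+ 2 = g ^+ 2 + 2 * (g * t) - 2 * (g * (s * t)) * r
    + t ^+ 2 * r ^+ 2.
  have -> : g ^+ 2 + 2 * (g * t) - 2 * (g * (s * t)) * r =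
      g ^+ 2 + 2 * (g * t) * (1 - s * r).
    by ring.
  by rewrite -rs; ring.
have e2 : - (2 * (g * (s * t)) * r) <= 2 * K * (1 + g ^+ 2).
  have h1 : - (2 * (g * (s * t))) <= K * (1 + g ^+ 2).
    move: st; rewrite ler_norml => /andP[st1 st2].
    have := sqr_ge0 (g + 1); have := sqr_ge0 (g - 1); rewrite !expr2.
    nra.
  have : 0 <= K * (1 + g ^+ 2) by rewrite mulr_ge0 ?addr_ge0 ?sqr_ge0.
  nra.
have e3 : t ^+ 2 * r ^+ 2 <= 4 * K.
  have r4 : r ^+ 2 <= 4 by rewrite expr2; nra.
  have := sqr_ge0 r; have := sqr_ge0 t; nra.
have e4 : 0 <= pi ^+ 2 * phi' ^+ 2 * s ^+ 2 by rewrite -!exprMn sqr_ge0.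
have e5 : 0 <= K * g ^+ 2 by rewrite mulr_ge0 ?sqr_ge0.
rewrite -/t e1; move: e2 e3 e4 e5; set G := g ^+ 2; set P := pi ^+ 2.
rewrite !expr2; lra.
Qed.

End variations.

(** * The first-order condition at a minimizer *)

Section first_variation.
Context {R : realType}.
Implicit Types (f g zeta phi : R -> R) (a b x t p q : R).
Notation mu := (@lebesgue_measure R).

(** If B were nonzero, take e of sign opposite to B and so small that the quadratic term is less
    than half the linear one in size. The same argument later yields the degenerate case of the
    Cauchy-Schwarz inequality. *)
Lemma linear_term_eq0 (B C e0 : R) : 0 < e0 ->
  (forall e, `|e| <= e0 -> 0 <= e * B + e ^+ 2 * C) -> B = 0.
Proof.
move=> e00 BC; apply/eqP; rewrite -normr_le0 leNgt; apply/negP => B0.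
pose D := `|C| + 1; have D0 : 0 < D by rewrite ltr_wpDl.
pose e := Num.min e0 (`|B| / (2 * D)).
have e_gt0 : 0 < e by rewrite lt_min e00 divr_gt0// mulr_gt0.
have eB : e * D <= `|B| / 2.
  rewrite -ler_pdivlMr// -mulrA -invfM ge_min; apply/orP; right.
  by rewrite lexx.
have CD : C < D by rewrite ltr_pwDr// ler_norm.
have : e * C <= e * D by rewrite ler_pM2l// ltW.
move=> eCD.
have := BC e; have := BC (- e); rewrite normrN (gtr0_norm e_gt0) sqrrN ge_min lexx.
move=> /(_ isT) h1 /(_ isT) h2.
have [B_ge0|B_lt0] := lerP 0 B.
- move: B0 eB; rewrite (ger0_norm B_ge0) => B0 eB.
  have : 0 <= e * (- B + e * C) by move: h1; rewrite expr2; lra.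
  rewrite pmulr_rge0//; lra.
- move: B0 eB; rewrite (ltr0_norm B_lt0) => B0 eB.
  have : 0 <= e * (B + e * C) by move: h2; rewrite expr2; lra.
  rewrite pmulr_rge0//; lra.
Qed.

Lemma action_variation_le t1 t2 phi z z' theta M eps : t1 < t2 -> t2 < t1 + 1 ->
  HT phi -> periodic z 1 -> periodic z' 1 ->
  (forall x, has_derivative z x (z' x)) -> continuous z' -> periodic theta 1 ->
  (forall x, has_derivative theta x (derive1 phi x * z x)) ->
  (forall x, `|z x| <= M) -> (forall x, `|z' x| <= M) -> `|eps| * M <= 2^-1 ->
  action t1 t2 (fun x => phi x + eps * theta x) <= action t1 t2 phi
   + eps * (\int[mu]_(x in `[t1, t2])
       (weak_derivative (log_deriv phi) x * z' x
        - 4 * pi ^+ 2 * derive1 phi x ^+ 2 * z x))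
   + eps ^+ 2 * (3 * M ^+ 2 *
       \int[mu]_(x in `[t1, t2]) (1 + weak_derivative (log_deriv phi) x ^+ 2)).
Proof.
move=> t12 t21 phiH zp z'p zD cz' thp thD zM z'M epsM.
set g := weak_derivative (log_deriv phi).
have z0 x : 0 < 1 + eps * z x.
  have := ler_norm (- (eps * z x)); rewrite normrN normrM.
  have := ler_wpM2l (normr_ge0 eps) (zM x); lra.
have [psiH psi'E var2 varw] := variation_log_deriv phiH zp z'p zD cz' thp thD z0.
have [_ uH] := phiH; have [g2 gw] := weak_derivativeP uH.
have phi'2 := HT_in_L2T_derive1 phiH.
have psi'2 := HT_in_L2T_derive1 psiH.
have z2 : in_L2T z.
  by apply: continuous_in_L2T => // x; exact: has_derivative_continuous (zD x).
have cz : continuous z by move=> x; exact: has_derivative_continuous (zD x).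
have cphi' : continuous (derive1 phi) by case: phiH => -[].
have z'2 := continuous_in_L2T z'p cz'.
have mI : measurable (`[t1, t2] : set (measurableTypeR R)) by [].
have i0 : mu.-integrable `[t1, t2] (EFin \o (fun x => g x ^+ 2)).
  exact: in_L2T_integrable_sqr.
have ic (f : R -> R) : continuous f -> mu.-integrable `[t1, t2] (EFin \o f).
  exact: continuous_integrable.
have i1 : mu.-integrable `[t1, t2]
    (EFin \o (fun x => g x ^+ 2 - 4 * pi ^+ 2 * derive1 phi x ^+ 2)).
  by apply: (integrableB mI i0 (ic _ _)); cont_auto.
have i2 : mu.-integrable `[t1, t2]
    (EFin \o (fun x => g x * z' x - 4 * pi ^+ 2 * derive1 phi x ^+ 2 * z x)).
  by apply: (integrableB mI (in_L2T_integrable_mul _ _ g2 z'2) (ic _ _)); cont_auto.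
have i3 : mu.-integrable `[t1, t2] (EFin \o (fun x => 1 + g x ^+ 2)).
  by apply: (integrableD mI (ic _ _) i0); cont_auto.
have iZ (k : R) (f : R -> R) : mu.-integrable `[t1, t2] (EFin \o f) ->
    mu.-integrable `[t1, t2] (EFin \o (fun x => k * f x)).
  exact: integrableZl.
rewrite (actionE t12 t21 var2 psiH varw).
set I1 := \int[mu]_(x in _) _; set J := \int[mu]_(x in _) _.
set K := \int[mu]_(x in _) _.
suff : I1 <= \int[mu]_(x in `[t1, t2])
    (g x ^+ 2 - 4 * pi ^+ 2 * derive1 phi x ^+ 2) + 2 * eps * J +
    6 * (eps * M) ^+ 2 * K.
  rewrite /action -/g; set I0 := \int[mu]_(x in _) _; rewrite exprMn; lra.
have i4 := iZ (2 * eps) _ i2; have i5 := iZ (6 * (eps * M) ^+ 2) _ i3.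
have i6 := integrableD mI i1 i4.
rewrite -RintegralZl// -RintegralZl// -(RintegralD mI i1 i4).
rewrite -(RintegralD mI i6 i5).
apply: le_Rintegral => //.
- exact: (integrableB mI (in_L2T_integrable_sqr _ _ var2)
    (iZ (4 * pi ^+ 2) _ (in_L2T_integrable_sqr _ _ psi'2))).
- exact: (integrableD mI i6 i5).
- move=> x _; rewrite psi'E /var_deriv; exact: var_deriv_bound.
Qed.

(** The integral condition makes the primitive [th] of phi' zeta return to 0 at t2. Hence the
    perturbation keeps the values p1 and p2 and extends periodically, while zeta = 0 at the
    endpoints keeps the slopes q1 and q2. *)
Lemma minimizer_first_variation t1 t2 p1 p2 q1 q2 phi zeta zeta' :
  t1 < t2 -> t2 < t1 + 1 ->
  is_minimizer (action t1 t2) (admissible t1 t2 p1 p2 q1 q2) phi ->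
  vanishes_outside t1 t2 zeta -> vanishes_outside t1 t2 zeta' ->
  (forall x, has_derivative zeta x (zeta' x)) -> continuous zeta' ->
  \int[mu]_(x in `[t1, t2]) (derive1 phi x * zeta x) = 0 ->
  \int[mu]_(x in `[t1, t2]) (weak_derivative (log_deriv phi) x * zeta' x
    - 4 * pi ^+ 2 * derive1 phi x ^+ 2 * zeta x) = 0.
Proof.
move=> t12 t21 [[phiH [phi1 phi2 phi'1 phi'2]] phimin] zv z'v zD cz' zI.
have cz : continuous zeta by move=> x; exact: has_derivative_continuous (zD x).
have [phid cphi' _ _] := phiH.1.
have phi'p := HT_derive1_periodic phiH.
have [F FD] : exists F, forall x, has_derivative F x (derive1 phi x * zeta x).
  by apply: continuous_antiderivative; cont_auto.
pose th x := F x - F t1.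
have thD x : has_derivative th x (derive1 phi x * zeta x).
  by apply: has_derivative_eq; [derive_auto|rewrite addr0].
have phizv : vanishes_outside t1 t2 (fun x => derive1 phi x * zeta x).
  by move=> x /zv ->; rewrite mulr0.
have th1 : th t1 = 0 by rewrite /th subrr.
have th2 : th t2 = 0.
  by rewrite /th -(@Rintegral_FTC2 _ (fun x => derive1 phi x * zeta x))//; cont_auto.
have thv := vanishes_outside_antiderivative phizv thD th1 th2.
have [M1 M10 zM1] := vanishes_outside_bounded (ltW t12) zv cz.
have [M2 M20 zM2] := vanishes_outside_bounded (ltW t12) z'v cz'.
pose M := M1 + M2; have M0 : 0 < M by rewrite addr_gt0.
pose C := 3 * M ^+ 2 *
  \int[mu]_(x in `[t1, t2]) (1 + weak_derivative (log_deriv phi) x ^+ 2).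
have e0 : 0 < (2 * M)^-1 by rewrite invr_gt0 mulr_gt0.
apply: (@linear_term_eq0 _ C _ e0) => e eM.
have eM' : `|e| * M <= 2^-1 by rewrite -ler_pdivlMr// -invfM.
have extD f f' x : vanishes_outside t1 t2 f -> vanishes_outside t1 t2 f' ->
    (forall y, has_derivative f y (f' y)) ->
    has_derivative (periodic_ext t1 f) x (periodic_ext t1 f' x).
  exact: has_derivative_periodic_ext.
have thextD x : has_derivative (periodic_ext t1 th) x
    (derive1 phi x * periodic_ext t1 zeta x).
  apply: has_derivative_eq; first exact: extD thv phizv thD.
  (* As phi' is 1-periodic, it passes unchanged through the integer shift of the extension. *)
  rewrite /periodic_ext; congr (_ * _).
  by rewrite -mulrNz periodic_int.
have zextD x : has_derivative (periodic_ext t1 zeta) x (periodic_ext t1 zeta' x).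
  exact: extD.
have extat f x : vanishes_outside t1 t2 f -> t1 <= x <= t2 ->
    periodic_ext t1 f x = f x.
  move=> fv /andP[t1x xt2]; apply: (periodic_ext_id fv) => //.
  by apply/andP; split; lra.
have t1I : t1 <= t1 <= t2 by rewrite lexx ltW.
have t2I : t1 <= t2 <= t2 by rewrite lexx ltW.
have zt1 : zeta t1 = 0 by rewrite zv// ltxx.
have zt2 : zeta t2 = 0 by rewrite zv// ltxx andbF.
have z0 x : 0 < 1 + e * periodic_ext t1 zeta x.
  have := ler_norm (- (e * periodic_ext t1 zeta x)); rewrite normrN normrM.
  have := ler_wpM2l (normr_ge0 e) (zM1 (x - (Num.floor (x - t1))%:~R)).
  rewrite -/(periodic_ext t1 zeta x) => h1 h2.
  have : `|e| * M1 <= `|e| * M by rewrite ler_wpM2l// lerDl ltW.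
  lra.
have czext : continuous (periodic_ext t1 zeta').
  exact: continuous_periodic_ext z'v cz'.
have := variation_log_deriv phiH (@periodic_ext_periodic _ t1 zeta)
  (@periodic_ext_periodic _ t1 zeta') zextD czext
  (@periodic_ext_periodic _ t1 th) thextD z0.
case=> psiH psi'E _ _.
have psiA : admissible t1 t2 p1 p2 q1 q2
    (fun x => phi x + e * periodic_ext t1 th x).
  split=> //; rewrite !psi'E !extat// th1 th2 zt1 zt2.
  by rewrite !mulr0 !addr0 !mulr1.
have := le_trans (phimin _ psiA) (@action_variation_le t1 t2 phi
  (periodic_ext t1 zeta) (periodic_ext t1 zeta') (periodic_ext t1 th) M e
  t12 t21 phiH (@periodic_ext_periodic _ t1 zeta)
  (@periodic_ext_periodic _ t1 zeta') zextD czext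
  (@periodic_ext_periodic _ t1 th) thextD _ _ eM').
have -> : \int[mu]_(x in `[t1, t2]) (weak_derivative (log_deriv phi) x *
    periodic_ext t1 zeta' x - 4 * pi ^+ 2 * derive1 phi x ^+ 2 *
    periodic_ext t1 zeta x) =
  \int[mu]_(x in `[t1, t2]) (weak_derivative (log_deriv phi) x * zeta' x
    - 4 * pi ^+ 2 * derive1 phi x ^+ 2 * zeta x).
  by apply: eq_Rintegral => x; rewrite inE/= in_itv/= => xI; rewrite !extat.
rewrite -addrA lerDl; apply.
- by move=> x; rewrite (le_trans (zM1 _))// lerDl ltW.
- by move=> x; rewrite (le_trans (zM2 _))// lerDr ltW.
Qed.

End first_variation.

(** * Regularity of the minimizer *)

Section orthogonal_projection.
Context {R : realType} (a b : R) (ab : a < b).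
Implicit Types (f g e s r w : R -> R) (x c : R) (S : set (R -> R)).
Notation mu := (@lebesgue_measure R).
Local Notation I := (Rintegral mu `[a, b]).

Lemma Rintegral_linear f g c : continuous f -> continuous g ->
  I (fun x => f x + c * g x) = I f + c * I g.
Proof.
move=> cf cg; rewrite RintegralD//; last 2 first.
- exact: continuous_integrable.
- by apply: continuous_integrable; cont_auto.
by rewrite RintegralZl//; exact: continuous_integrable.
Qed.

Lemma Rintegral_by_parts_vanishing f f' g g' :
  (forall x, has_derivative f x (f' x)) -> (forall x, has_derivative g x (g' x)) ->
  continuous f' -> continuous g' -> g a = 0 -> g b = 0 ->
  I (fun x => f' x * g x) = - I (fun x => f x * g' x).
Proof.
move=> fD gD cf' cg' ga gb.
have cf : continuous f by move=> x; exact: has_derivative_continuous (fD x).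
have cg : continuous g by move=> x; exact: has_derivative_continuous (gD x).
apply/eqP; rewrite -addr_eq0 -[X in _ + X]mul1r -Rintegral_linear; [|cont_auto..].
rewrite (@Rintegral_FTC2 _ _ (fun x => f x * g x))//.
- by rewrite ga gb !mulr0 subrr.
- by cont_auto.
- by move=> x _; apply: has_derivative_eq; [derive_auto|rewrite mul1r].
Qed.

(** A primitive is nondecreasing with equal values at a and b, hence constant between them, and f is
    its derivative. *)
Lemma Rintegral_ge0_eq0 f x : continuous f -> (forall y, 0 <= f y) ->
  I f = 0 -> a < x < b -> f x = 0.
Proof.
move=> cf f0 If0 /andP[ax xb].
have [F FD] := continuous_antiderivative cf.
have FI y z : y < z -> F z - F y = \int[mu]_(t in `[y, z]) f t.
  by move=> yz; rewrite (@Rintegral_FTC2 _ _ F).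
have Fle y z : y < z -> F y <= F z.
  by move=> yz; rewrite -subr_ge0 FI// Rintegral_ge0.
have Fab : F b = F a by apply/eqP; rewrite -subr_eq0 FI// If0.
have Fa y : a < y < b -> F y = F a.
  by move=> /andP[ay yb]; apply/le_anti/andP; split; [rewrite -Fab|];
      exact: Fle.
rewrite -(has_derivative_derive1 (FD x)); apply: has_derivative_derive1.
apply: has_derivative_near (has_derivative_cst x (F a)); near=> y.
rewrite Fa//; apply/andP; split; near: y; [exact: lt_nbhsr|exact: lt_nbhsl].
Unshelve. all: end_near. Qed.

Context (w : R -> R) (cw : continuous w) (w0 : forall x, 0 <= w x).

(** Existence of orthogonal projections for the w-weighted inner product, phrased so that it can be
    propagated one generator at a time. *)
Definition projectable S : Prop :=
  [/\ forall s, S s -> continuous s,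
      forall s r c, S s -> S r -> S (fun x => s x + c * r x) &
      forall f, continuous f -> exists2 s, S s &
        forall r, S r -> I (fun x => (f x - s x) * r x * w x) = 0].

Definition adjoin S e : set (R -> R) :=
  [set f | exists s c, S s /\ f = fun x => s x + c * e x].

Lemma projectable0 : projectable [set (fun=> 0)].
Proof.
split.
- by move=> s ->; exact: continuous_cstf.
- by move=> s r c -> ->; apply/funext => x /=; rewrite mulr0 addr0.
- move=> f cf; exists (fun=> 0) => // r ->.
  under eq_Rintegral do rewrite mulr0 mul0r.
  by rewrite Rintegral_cst// mul0r.
Qed.

(** One Gram-Schmidt step: [eo] is the part of e orthogonal to S, and the projection of f gains the
    component of [fo] along [eo]. Linearly dependent generators are covered by the case ee = 0. *)
Lemma projectable_adjoin S e : continuous e -> S (fun=> 0) -> projectable S ->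
  projectable (adjoin S e).
Proof.
move=> ce S0 [Sc SL SP]; split.
- by move=> _ [s [c [/Sc cs ->]]]; cont_auto.
- move=> _ _ d [s [c [Ss ->]]] [r [c' [Sr ->]]].
  exists (fun x => s x + d * r x), (c + d * c'); split; first exact: SL.
  by apply/funext => x; ring.
move=> f cf; have [Pe SPe ePe] := SP _ ce; have [Pf SPf fPf] := SP _ cf.
have cPe := Sc _ SPe; have cPf := Sc _ SPf.
pose eo x := e x - Pe x; pose fo x := f x - Pf x.
have ceo : continuous eo by rewrite /eo; cont_auto.
have cfo : continuous fo by rewrite /fo; cont_auto.
pose ee := I (fun x => eo x * eo x * w x).
pose fe := I (fun x => fo x * eo x * w x).
pose ff := I (fun x => fo x * fo x * w x).
(* Degenerate Cauchy-Schwarz: the weighted square norm of eo + d fo is nonnegative for every d, and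
   with ee = 0 its linear coefficient in d is 2 fe. *)
have ee0 : ee = 0 -> fe = 0.
  move=> ee0; suff : 2 * fe = 0 by lra.
  apply: (@linear_term_eq0 _ _ ff 1) => // d _.
  have -> : d * (2 * fe) + d ^+ 2 * ff = ee + (2 * d) * fe + d ^+ 2 * ff.
    by rewrite ee0; ring.
  rewrite -!Rintegral_linear; [|cont_auto..].
  apply: Rintegral_ge0 => x _.
  have -> : eo x * eo x * w x + 2 * d * (fo x * eo x * w x)
    + d ^+ 2 * (fo x * fo x * w x) = (eo x + d * fo x) ^+ 2 * w x by ring.
  by rewrite mulr_ge0// sqr_ge0.
(* When ee = 0 the quotient is 0 by convention, which is consistent because then fe = 0. *)
pose c := fe / ee.
have cE : fe = c * ee.
  by have [/[dup] h /ee0 ->|h] := eqVneq ee 0; rewrite /c ?h ?mulr0// divfK.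
exists (fun x => (Pf x + (- c) * Pe x) + c * e x).
  by exists (fun x => Pf x + (- c) * Pe x), c; split => //; exact: SL.
have ort r : S r -> I (fun x => (fo x - c * eo x) * r x * w x) = 0.
  move=> Sr; have cr := Sc _ Sr.
  transitivity (I (fun x => fo x * r x * w x) +
    (- c) * I (fun x => eo x * r x * w x)).
    rewrite -Rintegral_linear; [|cont_auto..].
    by apply: eq_Rintegral => x _; ring.
  by rewrite fPf// ePe// mulr0 addr0.
move=> _ [s [d [Ss ->]]]; have cs := Sc _ Ss.
(* Splits s + d e as (s + d Pe) + d eo. The residual is orthogonal to the members [s] and [Pe] of S,
   and to [eo] by the choice of c. *)
transitivity (I (fun x => (fo x - c * eo x) * s x * w x)
  + d * (I (fun x => (fo x - c * eo x) * Pe x * w x)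
  + 1 * (fe + (- c) * ee))).
  rewrite /fe /ee -!Rintegral_linear; [|cont_auto..].
  by apply: eq_Rintegral => x _; rewrite /fo /eo; ring.
by rewrite !ort// cE; ring.
Qed.

Lemma adjoin_sub S e s : S s -> adjoin S e s.
Proof.
by move=> Ss; exists s, 0; split => //; apply/funext => x; rewrite mul0r addr0.
Qed.

Lemma adjoin_new S e : S (fun=> 0) -> adjoin S e e.
Proof.
move=> S0; exists (fun=> 0), 1; split => //.
by apply/funext => x; rewrite mul1r add0r.
Qed.

End orthogonal_projection.

(** * The Euler-Lagrange equation in classical form *)

Section euler_lagrange.
Context {R : realType}.
Implicit Types (f g h phi : R -> R) (a b x t p q : R).
Notation mu := (@lebesgue_measure R).

Lemma eq_on_closed_itv f g a b : a < b -> continuous f -> continuous g ->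
  (forall x, a < x < b -> f x = g x) -> forall x, a <= x <= b -> f x = g x.
Proof.
move=> ab cf cg fg x /andP[ax xb].
move: ax; rewrite le_eqVlt => /orP[/eqP <-|ax].
  have h1 : f y @[y --> a^'+] --> f a := cvg_at_right_filter (cf a).
  apply: (cvg_unique _ h1) => //.
  apply: cvg_trans (cvg_at_right_filter (cg a)).
  by apply: near_eq_cvg; near=> y; rewrite fg//; apply/andP.
move: xb; rewrite le_eqVlt => /orP[/eqP ->|xb]; last by rewrite fg// ax.
have h1 : f y @[y --> b^'-] --> f b := cvg_at_left_filter (cf b).
apply: (cvg_unique _ h1) => //.
apply: cvg_trans (cvg_at_left_filter (cg b)).
by apply: near_eq_cvg; near=> y; rewrite fg//; apply/andP.
Unshelve. all: end_near. Qed.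

Lemma weak_derivative_by_parts phi f f' a b : a < b -> b < a + 1 -> HT phi ->
  vanishes_outside a b f -> vanishes_outside a b f' ->
  (forall x, has_derivative f x (f' x)) -> continuous f' ->
  \int[mu]_(x in `[a, b]) (weak_derivative (log_deriv phi) x * f x) =
  - \int[mu]_(x in `[a, b]) (log_deriv phi x * f' x).
Proof.
move=> ab ba [_ uH] fv f'v fD cf'.
have [g2 gw] := weak_derivativeP uH; have [u2 _] := uH.
have cf : continuous f by move=> x; exact: has_derivative_continuous (fD x).
have extD x : has_derivative (periodic_ext a f) x (periodic_ext a f' x).
  exact: has_derivative_periodic_ext fv f'v fD.
have ext1 : in_C1T (periodic_ext a f).
  apply: in_C1T_has_derivative extD _; first exact: periodic_ext_periodic.
  exact: continuous_periodic_ext f'v cf'.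
have := gw _ ext1.
have -> : derive1 (periodic_ext a f) = periodic_ext a f'.
  by apply/funext => x; exact: has_derivative_derive1.
rewrite (Rintegral_periodic_ext ab ba f'v cf' u2).
by rewrite (Rintegral_periodic_ext ab ba fv cf g2) => ->; rewrite opprK.
Qed.

(** [U] is C^2 on the whole line and agrees with log phi' only on [t1, t2]; two-sided derivatives
    are thus available at the endpoints, where log phi' itself may fail to be differentiable. *)
Lemma minimizer_log_deriv t1 t2 p1 p2 q1 q2 phi : t1 < t2 -> t2 < t1 + 1 ->
  is_minimizer (action t1 t2) (admissible t1 t2 p1 p2 q1 q2) phi ->
  exists U U' c, [/\ forall x, has_derivative U x (U' x),
    forall x, has_derivative U' x
      (c * derive1 phi x - 4 * pi ^+ 2 * derive1 phi x ^+ 2) &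
    forall x, t1 <= x <= t2 -> log_deriv phi x = U x].
Proof.
move=> t12 t21 phimin; have [[phiH _] _] := phimin.
have [phid cphi' _ _] := phiH.1; have cu := HT_continuous_log_deriv phiH.
have phiD x := derivable_has_derivative (phid x).
have cphi : continuous phi by move=> x; exact: has_derivative_continuous (phiD x).
have [F1 F1D] : exists F, forall x,
    has_derivative F x (4 * pi ^+ 2 * derive1 phi x ^+ 2).
  by apply: continuous_antiderivative; cont_auto.
have cF1 : continuous F1 by move=> x; exact: has_derivative_continuous (F1D x).
have [F2 F2D] := continuous_antiderivative cF1.
have cF2 : continuous F2 by move=> x; exact: has_derivative_continuous (F2D x).
have [Phi PhiD] := continuous_antiderivative cphi.
have cPhi : continuous Phi by move=> x; exact: has_derivative_continuous (PhiD x).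
pose I := Rintegral mu `[t1, t2].
(* The test function is the double primitive H2 of h. The three moments of h ensure in turn H1(t2) =
   0, H2(t2) = 0 and int phi' H2 = 0. Integrating by parts until only h remains turns the first
   variation into the claim, with F2'' = 4 pi^2 phi'^2. *)
have weak h : continuous h -> vanishes_outside t1 t2 h -> I h = 0 ->
    I (fun x => x * h x) = 0 -> I (fun x => Phi x * h x) = 0 ->
    I (fun x => (log_deriv phi x + F2 x) * h x) = 0.
  move=> ch hv h0 h1 h2.
  have prim k : continuous k -> exists K, (forall x, has_derivative K x (k x)) /\
      K t1 = 0 /\ K t2 = I k.
    move=> ck; have [K KD] := continuous_antiderivative ck.
    exists (fun x => K x + - K t1); split; last split.
    - by move=> x; apply: has_derivative_eq; [derive_auto|rewrite addr0].
    - by rewrite subrr.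
    - by rewrite /I (@Rintegral_FTC2 _ _ K).
  have [H1 [H1D [H11]]] := prim _ ch; rewrite h0 => H12.
  have cH1 : continuous H1 by move=> x; exact: has_derivative_continuous (H1D x).
  have H1v := vanishes_outside_antiderivative hv H1D H11 H12.
  have [H2 [H2D [H21]]] := prim _ cH1.
  have -> : I H1 = 0.
    rewrite -[H1](_ : (fun x => 1 * H1 x) = H1); last first.
      by apply/funext => x; rewrite mul1r.
    rewrite /I (@Rintegral_by_parts_vanishing _ _ _ t12 (fun x => x) (fun=> 1)
      _ h)//.
    - by rewrite -/(I _) h1 oppr0.
    - by move=> x; derive_auto.
    - by cont_auto.
  move=> H22.
  have cH2 : continuous H2 by move=> x; exact: has_derivative_continuous (H2D x).
  have H2v := vanishes_outside_antiderivative H1v H2D H21 H22.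
  have phiH2 : I (fun x => derive1 phi x * H2 x) = 0.
    rewrite /I (Rintegral_by_parts_vanishing t12 phiD H2D)//.
    rewrite (Rintegral_by_parts_vanishing t12 PhiD H1D)//.
    by rewrite -/(I _) h2 !oppr0.
  have := minimizer_first_variation t12 t21 phimin H2v H1v H2D cH1 phiH2.
  have [g2 _] := weak_derivativeP phiH.2.
  rewrite RintegralB//; last 2 first.
  - exact: in_L2T_integrable_mul_continuous.
  - by apply: continuous_integrable; cont_auto.
  rewrite (weak_derivative_by_parts t12 t21 phiH H1v hv H1D ch).
  rewrite (Rintegral_by_parts_vanishing t12 F1D H2D)//; last by cont_auto.
  rewrite (Rintegral_by_parts_vanishing t12 F2D H1D)//.
  rewrite opprK => /eqP; rewrite -opprD oppr_eq0 => /eqP <-.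
  rewrite -RintegralD//; last 2 first.
  - by apply: continuous_integrable; cont_auto.
  - by apply: continuous_integrable; cont_auto.
  by apply: eq_Rintegral => x _; rewrite mulrDl.
(* Positive inside ]t1, t2[ and zero elsewhere, so that residual times weight is itself an allowed
   test function h. *)
pose w x := Num.max ((x - t1) * (t2 - x)) 0.
have cw : continuous w by rewrite /w; cont_auto.
have w0 x : 0 <= w x by rewrite le_max lexx orbT.
have wv : vanishes_outside t1 t2 w.
  move=> x; rewrite negb_and -!leNgt => xt; rewrite /w max_r//.
  by case/orP: xt => xt; nra.
pose S1 := adjoin [set (fun=> 0)] (fun=> 1 : R).
pose S2 := adjoin S1 (fun x => x).
pose S3 := adjoin S2 Phi.
have S1P : projectable t1 t2 w S1.
  apply: projectable_adjoin => //; last exact: projectable0.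
  exact: continuous_cstf.
have S10 : S1 (fun=> 0) by exact: adjoin_sub.
have S2P : projectable t1 t2 w S2.
  by apply: projectable_adjoin => //; exact: continuous_idf.
have S20 : S2 (fun=> 0) by exact: adjoin_sub.
have S3P : projectable t1 t2 w S3 by exact: projectable_adjoin.
have cf : continuous (fun x => log_deriv phi x + F2 x) by cont_auto.
have [S3c _ /(_ _ cf)[s S3s sort]] := S3P.
have cs := S3c _ S3s.
pose r x := (log_deriv phi x + F2 x) - s x.
have cr : continuous r by rewrite /r; cont_auto.
pose h x := r x * w x.
have ch : continuous h by rewrite /h; cont_auto.
have ort k : S3 k -> I (fun x => k x * h x) = 0.
  by move=> /sort <-; apply: eq_Rintegral => x _; rewrite /h /r; ring.
have hv : vanishes_outside t1 t2 h by move=> x /wv; rewrite /h => ->; rewrite mulr0.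
have S31 : S3 (fun=> 1).
  by do 2 apply: adjoin_sub; exact: adjoin_new.
have S3x : S3 (fun x => x) by apply: adjoin_sub; exact: adjoin_new.
have S3Phi : S3 Phi by exact: adjoin_new.
have hI : I h = 0.
  by rewrite -(ort _ S31); apply: eq_Rintegral => x _; rewrite mul1r.
have fh := weak h ch hv hI (ort _ S3x) (ort _ S3Phi).
(* Since r = (u + F2) - s, the weighted square of r is the difference of the pairings of h with u +
   F2 and with s. The first vanishes by the variational identity, the second by orthogonality. *)
have rr0 : I (fun x => r x ^+ 2 * w x) = 0.
  transitivity (I (fun x => (log_deriv phi x + F2 x) * h x)
      + (-1) * I (fun x => s x * h x)).
    rewrite -Rintegral_linear; [|cont_auto..].
    by apply: eq_Rintegral => x _; rewrite /h /r; ring.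
  by rewrite fh ort// mulr0 addr0.
have r0 x : t1 < x < t2 -> r x = 0.
  move=> xt.
  have crr : continuous (fun x => r x ^+ 2 * w x) by cont_auto.
  have rw0 y : 0 <= r y ^+ 2 * w y by rewrite mulr_ge0// sqr_ge0.
  have /eqP := Rintegral_ge0_eq0 t12 crr rw0 rr0 xt.
  rewrite mulf_eq0 sqrf_eq0 => /orP[/eqP//|].
  move: xt => /andP[tx xt]; rewrite gt_eqF//.
  by rewrite lt_max mulr_gt0 ?subr_gt0.
(* Unfolds the projection as s = a + b x + c Phi. Since Phi'' = phi', the coefficient of [Phi]
   becomes the multiplier in the equation for U = s - F2. *)
have [s2 [c [[s1 [b [[_ [a [-> ->]]] ->]]] sE]]] := S3s.
exists (fun x => s x - F2 x), (fun x => b + c * phi x - F1 x), c; split.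
- move=> x; rewrite sE; apply: has_derivative_eq; first by derive_auto.
  by rewrite /=; ring.
- move=> x; apply: has_derivative_eq; first by derive_auto.
  by rewrite /=; ring.
- apply: eq_on_closed_itv => //; first by cont_auto.
  by move=> x /r0; rewrite /r => /eqP; rewrite subr_eq0 => /eqP <-; rewrite addrK.
Qed.

End euler_lagrange.

(** * Linearization by projective coordinates *)

Section projective_ode.
Context {R : realType}.
Implicit Types (y z C S U phi : R -> R) (a b c d k l m r t x p q : R).

(* [cos]/[sin] at frequency [l] (k = -l), [1]/[x] (k = 0) and [cosh]/[sinh]
   (k = l) at once. *)
Definition fundamental_pair k l C S : Prop :=
  [/\ forall x, has_derivative C x (k * S x),
      forall x, has_derivative S x (l * C x) &
      forall x, l * C x ^+ 2 - k * S x ^+ 2 = l].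

(** Solving y = A C + B S, z = k A S + l B C for A and B by Cramer's rule gives two expressions
    whose derivatives vanish along the system. Their constant values are the coefficients. *)
Lemma fundamental_pair_solution y z C S k l a b : a <= b -> l != 0 ->
  fundamental_pair k l C S ->
  (forall x, a <= x <= b -> has_derivative y x (z x)) ->
  (forall x, a <= x <= b -> has_derivative z x (k * l * y x)) ->
  exists A B, forall x, a <= x <= b ->
    y x = A * C x + B * S x /\ z x = k * A * S x + l * B * C x.
Proof.
move=> ab l0 [CD SD CS] yD zD.
pose A x := y x * C x - z x * S x * l^-1.
pose B x := z x * C x * l^-1 - k * (y x * S x) * l^-1.
have sub x t : a <= x <= b -> a <= t <= x -> a <= t <= b.
  by move=> /andP[_ xb] /andP[-> tx]; exact: le_trans xb.
have AE x : a <= x <= b -> A x = A a.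
  move=> xab; have /andP[ax _] := xab.
  apply: (has_derivative0_segment ax) => t /(sub _ _ xab) tab.
  have ty := yD t tab; have tz := zD t tab; have tC := CD t; have tS := SD t.
  apply: has_derivative_eq; first by rewrite /A; derive_auto.
  by rewrite /=; field.
have BE x : a <= x <= b -> B x = B a.
  move=> xab; have /andP[ax _] := xab.
  apply: (has_derivative0_segment ax) => t /(sub _ _ xab) tab.
  have ty := yD t tab; have tz := zD t tab; have tC := CD t; have tS := SD t.
  apply: has_derivative_eq; first by rewrite /B; derive_auto.
  by rewrite /=; field.
exists (A a), (B a) => x xab; rewrite -(AE x)// -(BE x)//.
have CS1 : C x ^+ 2 - k * S x ^+ 2 / l = 1.
  by apply: (mulfI l0); rewrite mulr1 -[RHS](CS x); field.
split.
- rewrite -[LHS]mulr1 -CS1 /A /B; field; exact: l0.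
- rewrite -[LHS]mulr1 -CS1 /A /B; field; exact: l0.
Qed.

(* With [phi' = expR U], the functions [phi'^(-1/2) sin (pi phi)] and
   [phi'^(-1/2) cos (pi phi)] solve the same equation [y'' = - m y], because
   the Schwarzian of [tan (pi phi)] is a first integral. *)
Lemma projective_linearization phi U U' c a b : a <= b ->
  (forall x, derivable phi x 1) ->
  (forall x, has_derivative U x (U' x)) ->
  (forall x, has_derivative U' x
    (c * derive1 phi x - 4 * pi ^+ 2 * derive1 phi x ^+ 2)) ->
  (forall x, a <= x <= b -> derive1 phi x = expR (U x)) ->
  exists m z1 z2,
  let y1 := fun x => expR (- (U x * 2^-1)) * sin (pi * phi x) in
  let y2 := fun x => expR (- (U x * 2^-1)) * cos (pi * phi x) in
  forall x, a <= x <= b ->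
  [/\ has_derivative y1 x (z1 x) /\ has_derivative z1 x (- m * y1 x),
      has_derivative y2 x (z2 x) /\ has_derivative z2 x (- m * y2 x) &
      z1 x * y2 x - y1 x * z2 x = pi].
Proof.
move=> ab phid UD U'D phi'E.
pose Q x := c * expR (U x) - 2 * pi ^+ 2 * expR (U x) ^+ 2 - 2^-1 * U' x ^+ 2.
have QE x : a <= x <= b -> Q x = Q a.
  move=> /andP[ax xb]; apply: (has_derivative0_segment ax) => t /andP[a_t tx].
  have tU := UD t; have tU' := U'D t.
  apply: has_derivative_eq; first by rewrite /Q; derive_auto.
  by rewrite phi'E ?a_t ?(le_trans tx)//= ; field.
pose z1 x := - (2^-1 * U' x) * (expR (- (U x * 2^-1)) * sin (pi * phi x))
  + pi * (expR (U x * 2^-1) * cos (pi * phi x)).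
pose z2 x := - (2^-1 * U' x) * (expR (- (U x * 2^-1)) * cos (pi * phi x))
  - pi * (expR (U x * 2^-1) * sin (pi * phi x)).
exists (Q a / 2), z1, z2 => y1 y2 x xab.
have phiD : has_derivative phi x (expR (U x)).
  by rewrite -(phi'E _ xab); exact: derivable_has_derivative.
pose E := expR (U x * 2^-1).
have E0 : E != 0 by rewrite gt_eqF// expR_gt0.
have EU : expR (U x) = E ^+ 2.
  by rewrite expr2 -expRD; congr expR; field.
have EN : expR (- (U x * 2^-1)) = E^-1 by rewrite expRN.
have QxE := QE x xab.
split; [split|split|].
- apply: has_derivative_eq; first by rewrite /y1; derive_auto.
  by rewrite /= /z1 EU EN -/E; field.
- apply: has_derivative_eq; first by rewrite /z1; derive_auto.
  by rewrite /= (phi'E _ xab) -QxE /Q /y1 EU EN -/E; field.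
- apply: has_derivative_eq; first by rewrite /y2; derive_auto.
  by rewrite /= /z2 EU EN -/E; field.
- apply: has_derivative_eq; first by rewrite /z2; derive_auto.
  by rewrite /= (phi'E _ xab) -QxE /Q /y2 EU EN -/E; field.
- rewrite /z1 /z2 /y1 /y2 EN -/E.
  transitivity (pi * (cos (pi * phi x) ^+ 2 + sin (pi * phi x) ^+ 2)).
    by field.
  by rewrite cos2Dsin2 mulr1.
Qed.

(** The point of the projective line with homogeneous coordinates (S, C). *)
Definition ratio (C S : R) : option R := if C == 0 then None else Some (S / C).

(** In homogeneous coordinates a Moebius map is linear and the common factor r cancels. The poles on
    the two sides match because cos u is r times the transformed denominator. *)
Lemma ptan_moebius u r a b c d (C S : R) : r != 0 -> (C, S) != (0, 0) ->
  sin u = r * (a * S + b * C) -> cos u = r * (c * S + d * C) ->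
  ptan u = moebius a b c d (ratio C S).
Proof.
move=> r0 CS sE cE; rewrite /ptan /tan sE cE /ratio.
have [C0|C0] := eqVneq C 0.
  have S0 : S != 0 by move: CS; rewrite C0 xpair_eqE eqxx.
  rewrite C0 !mulr0 !addr0 !mulf_eq0 (negbTE r0) (negbTE S0) orbF/=.
  have [//|c0] := eqVneq c 0.
  by congr Some; field; rewrite r0 c0 S0.
rewrite /=; have -> : c * (S / C) + d = (c * S + d * C) / C by field.
rewrite !mulf_eq0 invr_eq0 (negbTE r0) (negbTE C0) orbF/=.
have [//|cd0] := eqVneq (c * S + d * C) 0.
by congr Some; field; rewrite r0 cd0 C0.
Qed.

(** The number m comes before the pair, so that [C] and [S] can be chosen according to its sign. [D]
    is given by the subtraction formula of [S]. The last identity expresses sin (pi (phi x - p1))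
    through the values at x and t1 of the two linearized solutions; at x = t2 it contains kappa. *)
Lemma minimizer_projective t1 t2 p1 p2 q1 q2 phi : t1 < t2 -> t2 < t1 + 1 ->
  is_minimizer (action t1 t2) (admissible t1 t2 p1 p2 q1 q2) phi ->
  exists m, forall C S k l (D : R -> R), 0 < l -> - m = k * l ->
  fundamental_pair k l C S ->
  (forall x t, D (x - t) = S x * C t - C x * S t) ->
  exists a b c d, [/\ a * d - b * c = 1,
    forall x, t1 <= x <= t2 ->
      ptan (pi * phi x) = moebius a b c d (ratio (C x) (S x)) &
    forall x, t1 <= x <= t2 ->
      l * sin (pi * (phi x - p1)) =
      Num.sqrt (q1 * derive1 phi x) * pi * D (x - t1)].
Proof.
move=> t12 t21 phimin.
have [U [U' [c0 [UD U'D Uu]]]] := minimizer_log_deriv t12 t21 phimin.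
have [[[[phid _ _ phi0] _] [phi1 phi2 phi'1 phi'2]] _] := phimin.
have phi'E x : t1 <= x <= t2 -> derive1 phi x = expR (U x).
  by move=> xt; rewrite -Uu// lnK// posrE; exact: phi0.
have [m [z1 [z2 yz]]] :=
  projective_linearization (ltW t12) phid UD U'D phi'E.
exists m => C S k l D l0 mkl CS DE.
have lN0 : l != 0 by rewrite gt_eqF.
have [b [a y1E]] : exists A B, forall x, t1 <= x <= t2 ->
    expR (- (U x * 2^-1)) * sin (pi * phi x) = A * C x + B * S x /\
    z1 x = k * A * S x + l * B * C x.
  apply: (fundamental_pair_solution (ltW t12) lN0 CS) => x /yz[[? h] _ _] //.
  by rewrite -mkl.
have [d [c y2E]] : exists A B, forall x, t1 <= x <= t2 ->
    expR (- (U x * 2^-1)) * cos (pi * phi x) = A * C x + B * S x /\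
    z2 x = k * A * S x + l * B * C x.
  apply: (fundamental_pair_solution (ltW t12) lN0 CS) => x /yz[_ [? h] _] //.
  by rewrite -mkl.
have [_ _ CS1] := CS.
have t1I : t1 <= t1 <= t2 by rewrite lexx ltW.
(* The Wronskian of the two solutions is pi, and in terms of the coefficients it is (a d - b c)(l
   C^2 - k S^2) = (a d - b c) l. *)
have W : l * (a * d - b * c) = pi.
  have [_ _ <-] := yz _ t1I.
  have [-> ->] := y1E _ t1I; have [-> ->] := y2E _ t1I.
  by rewrite -[in LHS](CS1 t1); ring.
have pi0 : 0 < pi :> R by exact: pi_gt0.
(* The determinant a d - b c equals pi / l = s^2, so dividing all four coefficients by s normalizes
   it to 1. *)
pose s := Num.sqrt (pi / l).
have s0 : s != 0 by rewrite gt_eqF// sqrtr_gt0 divr_gt0.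
have ss : s ^+ 2 = pi / l by rewrite sqr_sqrtr// divr_ge0// ltW.
have adbc : a * d - b * c = s ^+ 2 by rewrite ss -W; field.
exists (a / s), (b / s), (c / s), (d / s); split.
- have -> : a / s * (d / s) - b / s * (c / s) = (a * d - b * c) / s ^+ 2 by field.
  by rewrite adbc divff// expf_neq0.
- move=> x xI; have [h1 _] := y1E _ xI; have [h2 _] := y2E _ xI.
  apply: (@ptan_moebius _ (expR (U x * 2^-1) * s)).
  + by rewrite mulf_neq0// gt_eqF// expR_gt0.
  + apply/negP; rewrite xpair_eqE => /andP[/eqP C0 /eqP S0].
    have := CS1 x; rewrite C0 S0 expr0n/= !mulr0 subrr => /esym/eqP.
    by rewrite (negbTE lN0).
  + have -> : sin (pi * phi x) =
        expR (U x * 2^-1) * (expR (- (U x * 2^-1)) * sin (pi * phi x)).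
      by rewrite mulrA expRxMexpNx_1 mul1r.
    by rewrite h1; field.
  + have -> : cos (pi * phi x) =
        expR (U x * 2^-1) * (expR (- (U x * 2^-1)) * cos (pi * phi x)).
      by rewrite mulrA expRxMexpNx_1 mul1r.
    by rewrite h2; field.
- move=> x xI; have [h1 _] := y1E _ xI; have [h2 _] := y2E _ xI.
  have [h3 _] := y1E _ t1I; have [h4 _] := y2E _ t1I.
  have -> : Num.sqrt (q1 * derive1 phi x) =
      expR (U t1 * 2^-1) * expR (U x * 2^-1).
    rewrite -phi'1 !phi'E// -expRD.
    have -> : expR (U t1 + U x) = (expR (U t1 * 2^-1) * expR (U x * 2^-1)) ^+ 2.
      by rewrite -expRD expr2 -expRD; congr expR; field.
    by rewrite sqrtr_sqr ger0_norm// mulr_ge0// expR_ge0.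
  have -> : sin (pi * (phi x - p1)) = expR (U t1 * 2^-1) * expR (U x * 2^-1) *
     ((expR (- (U x * 2^-1)) * sin (pi * phi x)) *
      (expR (- (U t1 * 2^-1)) * cos (pi * phi t1)) -
      (expR (- (U x * 2^-1)) * cos (pi * phi x)) *
      (expR (- (U t1 * 2^-1)) * sin (pi * phi t1))).
    rewrite phi1 mulrBr sinB !expRN; field.
    by rewrite !gt_eqF// expR_gt0.
  by rewrite h1 h2 h3 h4 DE -W; ring.
Qed.

End projective_ode.

(** * Monotonicity of [x / sin x] and [x / sinh x] *)

Section sine_ratios.
Context {R : realType}.
Implicit Types (f : R -> R) (l r x y : R).

Lemma mean_value f f' x y : x < y ->
  (forall t, has_derivative f t (f' t)) ->
  exists2 t, x < t < y & f y - f x = f' t * (y - x).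
Proof.
move=> xy fD; have fD' t : t \in `]x, y[%R -> is_derive t 1 f (f' t).
  by move=> _; exact: fD.
have cf : {within `[x, y], continuous f}.
  by apply: continuous_subspaceT => t; exact: has_derivative_continuous (fD t).
have [t] := MVT xy fD' cf.
by rewrite in_itv/= => xty ->; exists t.
Qed.

Lemma sin_lt_id x : 0 < x -> x < pi -> sin x < x.
Proof.
move=> x0 xpi; have [t|t /andP[t0 tx]] := @mean_value sin cos 0 x x0.
  exact: is_derive_sin.
rewrite sin0 !subr0 => ->; rewrite gtr_pMl// -cos0 ltr_cos//.
  by rewrite in_itv/= lexx pi_ge0.
by rewrite in_itv/= !ltW// (lt_trans tx).
Qed.

(** Strict monotonicity of x / sin x in division-free form, to be used with r = x / y. The
    difference of the two sides starts at 0 and has derivative r (cos (r t) - cos t) > 0. *)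
Lemma sin_mul_gt r x : 0 < r < 1 -> 0 < x < pi -> r * sin x < sin (r * x).
Proof.
move=> /andP[r0 r1] /andP[x0 xpi].
have [t|t /andP[t0 tx]] := @mean_value (fun t => sin (r * t) - r * sin t)
    (fun t => r * (cos (r * t) - cos t)) 0 x x0.
  by apply: has_derivative_eq; [derive_auto|rewrite /=; ring].
rewrite mulr0 sin0 mulr0 !subr0 => e.
rewrite -subr_gt0 e mulr_gt0// mulr_gt0// subr_gt0.
have rt : r * t < t by rewrite gtr_pMl.
have rt0 : 0 < r * t by rewrite mulr_gt0.
by rewrite ltr_cos// in_itv/=; apply/andP; split; lra.
Qed.

Lemma sin_ratio_inj x y : 0 < x < pi -> 0 < y < pi ->
  x / sin x = y / sin y -> x = y.
Proof.
wlog xy : x y / x < y.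
  move=> H x0 y0 e; have [xy|xy|//] := ltgtP x y; first exact: H.
  by apply/esym/H.
move=> x0 y0 e; have [sx sy] : 0 < sin x /\ 0 < sin y by split; exact: sin_gt0_pi.
move: (x0) (y0) => /andP[x0' _] /andP[y0' _].
have r01 : 0 < x / y < 1 by rewrite divr_gt0//= ltr_pdivrMr// mul1r.
have := sin_mul_gt r01 y0; rewrite divfK ?gt_eqF//.
move/eqP: e; rewrite eqr_div ?lt0r_neq0// => /eqP e.
by rewrite mulrAC e mulrAC divff ?lt0r_neq0// mul1r ltxx.
Qed.

Lemma has_derivative_sinh x : has_derivative (@sinh R) x (cosh x).
Proof.
apply: has_derivative_eq; first by rewrite /sinh; derive_auto.
by rewrite /cosh /=; field.
Qed.

Lemma has_derivative_cosh x : has_derivative (@cosh R) x (sinh x).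
Proof.
apply: has_derivative_eq; first by rewrite /cosh; derive_auto.
by rewrite /sinh /=; field.
Qed.

Lemma sinh0 : sinh (0 : R) = 0.
Proof. by rewrite /sinh oppr0 subrr mul0r. Qed.

Lemma cosh0 : cosh (0 : R) = 1.
Proof. by rewrite /cosh oppr0 expR0; field. Qed.

Lemma cosh_gt0 x : 0 < cosh x.
Proof. by rewrite /cosh divr_gt0// addr_gt0 ?expR_gt0. Qed.

Lemma cosh2Bsinh2 x : cosh x ^+ 2 - sinh x ^+ 2 = 1.
Proof. by rewrite /cosh /sinh -[RHS](expRxMexpNx_1 x); field. Qed.

Lemma sinhB x y : sinh (x - y) = sinh x * cosh y - cosh x * sinh y.
Proof.
by rewrite /sinh /cosh opprB !expRD; field.
Qed.

Lemma sinh_gt0 x : 0 < x -> 0 < sinh x.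
Proof.
move=> x0; have [t|t _] := @mean_value (@sinh R) (@cosh R) 0 x x0.
  exact: has_derivative_sinh.
by rewrite sinh0 !subr0 => ->; rewrite mulr_gt0// cosh_gt0.
Qed.

Lemma cosh_lt x y : 0 <= x -> x < y -> cosh x < cosh y.
Proof.
move=> x0 xy; have [t|t /andP[xt ty]] := @mean_value (@cosh R) (@sinh R) x y xy.
  exact: has_derivative_cosh.
rewrite -subr_gt0 => ->; rewrite mulr_gt0 ?subr_gt0// sinh_gt0//.
exact: le_lt_trans xt.
Qed.

Lemma id_lt_sinh x : 0 < x -> x < sinh x.
Proof.
move=> x0; have [t|t /andP[t0 tx]] := @mean_value (@sinh R) (@cosh R) 0 x x0.
  exact: has_derivative_sinh.
by rewrite sinh0 !subr0 => ->; rewrite ltr_pMl// -cosh0 cosh_lt.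
Qed.

(** The hyperbolic counterpart: cosh increases on the nonnegative axis, so the inequality is
    reversed. *)
Lemma sinh_mul_lt r x : 0 < r < 1 -> 0 < x -> sinh (r * x) < r * sinh x.
Proof.
move=> /andP[r0 r1] x0.
have sD t : has_derivative (fun t => sinh (r * t)) t (cosh (r * t) * r).
  apply: (@has_derivative_comp _ (fun t => r * t)).
    exact: has_derivative_sinh.
  by apply: has_derivative_eq; [derive_auto|rewrite /=; ring].
have [t|t /andP[t0 tx]] := @mean_value (fun t => sinh (r * t) - r * sinh t)
    (fun t => r * (cosh (r * t) - cosh t)) 0 x x0.
  have tD := has_derivative_sinh t.
  by apply: has_derivative_eq; [derive_auto|rewrite /=; ring].
rewrite mulr0 sinh0 mulr0 !subr0 => e.
have rt : r * t < t by rewrite gtr_pMl.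
rewrite -subr_lt0 e nmulr_rlt0// pmulr_rlt0// subr_lt0 cosh_lt//.
by rewrite ltW// mulr_gt0.
Qed.

Lemma sinh_ratio_inj x y : 0 < x -> 0 < y -> x / sinh x = y / sinh y -> x = y.
Proof.
wlog xy : x y / x < y.
  move=> H x0 y0 e; have [xy|xy|//] := ltgtP x y; first exact: H.
  by apply/esym/H.
move=> x0 y0 e; have [sx sy] : 0 < sinh x /\ 0 < sinh y by split; exact: sinh_gt0.
have r01 : 0 < x / y < 1 by rewrite divr_gt0//= ltr_pdivrMr// mul1r.
have := sinh_mul_lt r01 y0; rewrite divfK ?gt_eqF//.
move/eqP: e; rewrite eqr_div ?lt0r_neq0// => /eqP e.
by rewrite mulrAC e mulrAC divff ?lt0r_neq0// mul1r ltxx.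
Qed.

Lemma fundamental_pair_trig l :
  fundamental_pair (- l) l (fun x => cos (l * x)) (fun x => sin (l * x)).
Proof.
split=> x.
- by apply: has_derivative_eq; [derive_auto|rewrite /=; ring].
- by apply: has_derivative_eq; [derive_auto|rewrite /=; ring].
- by rewrite mulNr opprK -mulrDr cos2Dsin2 mulr1.
Qed.

Lemma fundamental_pair_affine : fundamental_pair 0 1 (fun=> 1 : R) (fun x => x).
Proof.
split=> x.
- by rewrite mul0r; derive_auto.
- by rewrite mulr1; derive_auto.
- by rewrite mul0r subr0 expr1n mulr1.
Qed.

Lemma fundamental_pair_hyperbolic l :
  fundamental_pair l l (fun x => cosh (l * x)) (fun x => sinh (l * x)).
Proof.
have lD x : has_derivative (fun t => l * t) x l.
  by apply: has_derivative_eq; [derive_auto|rewrite /=; ring].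
split=> x.
- rewrite mulrC.
  exact: (@has_derivative_comp _ (fun t => l * t)) (has_derivative_cosh _) (lD x).
- rewrite mulrC.
  exact: (@has_derivative_comp _ (fun t => l * t)) (has_derivative_sinh _) (lD x).
- by rewrite -mulrBr cosh2Bsinh2 mulr1.
Qed.

End sine_ratios.

Theorem proposition17 (R : realType) (t1 t2 p1 p2 q1 q2 : R)
  (ht12 : t1 < t2) (ht21 : t2 < t1 + 1)
  (hp12 : p1 < p2) (hp21 : p2 < p1 + 1)
  (hq1 : 0 < q1) (hq2 : 0 < q2)
  (phi psi : R -> R)
  (hphi : is_minimizer (action t1 t2) (admissible t1 t2 p1 p2 q1 q2) phi)
  (hpsi : forall tau, t1 <= tau <= t2 -> psi tau = phi tau) :
  let kappa := pi * Num.sqrt (q1 * q2) * (t2 - t1) / sin (pi * (p2 - p1)) in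
  exists a b c d : R, a * d - b * c = 1 /\
  [/\ 1 < kappa ->
        let is_lambda := fun lambda : R =>
          [/\ 0 < lambda, lambda < pi / (t2 - t1) &
              lambda * (t2 - t1) / sin (lambda * (t2 - t1)) = kappa] in
        (exists lambda, is_lambda lambda) /\
        forall lambda, is_lambda lambda -> forall tau, t1 <= tau <= t2 ->
          ptan (pi * psi tau) = moebius a b c d (ptan (lambda * tau)),
      kappa = 1 ->
        forall tau, t1 <= tau <= t2 ->
          ptan (pi * psi tau) = moebius a b c d (Some tau) &
      kappa < 1 ->
        let is_lambda := fun lambda : R =>
          0 < lambda /\
          lambda * (t2 - t1) / sinh (lambda * (t2 - t1)) = kappa in
        (exists lambda, is_lambda lambda) /\
        forall lambda, is_lambda lambda -> forall tau, t1 <= tau <= t2 ->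
          ptan (pi * psi tau) = moebius a b c d (Some (tanh (lambda * tau)))].
Proof.
move=> kappa.
have [m mP] := minimizer_projective ht12 ht21 hphi.
have [[[[phid _ _ phi0] _] [phi1 phi2 phi'1 phi'2]] _] := hphi.
have T0 : 0 < t2 - t1 by rewrite subr_gt0.
have phiD x := derivable_has_derivative (phid x).
have phi_lt x y : x < y -> phi x < phi y.
  move=> xy; have [t _ e] := mean_value xy phiD.
  by rewrite -subr_gt0 e mulr_gt0 ?subr_gt0//; exact: phi0.
(* As phi increases from p1 to p2 < p1 + 1, the angle stays in ]0, pi[. *)
have sin_gt0 x : t1 < x <= t2 -> 0 < sin (pi * (phi x - p1)).
  move=> /andP[tx xt]; apply: sin_pi_gt0; have := phi_lt _ _ tx.
  have : phi x <= phi t2.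
    by move: xt; rewrite le_eqVlt => /orP[/eqP ->//|/phi_lt/ltW].
  by rewrite phi1 phi2 => *; apply/andP; split; lra.
have sqrt_gt0 x : 0 < Num.sqrt (q1 * derive1 phi x) * pi.
  by rewrite mulr_gt0 ?pi_gt0// sqrtr_gt0 mulr_gt0//; exact: phi0.
have D_gt0 l (D : R -> R) : 0 < l ->
    (forall x, t1 <= x <= t2 -> l * sin (pi * (phi x - p1)) =
      Num.sqrt (q1 * derive1 phi x) * pi * D (x - t1)) ->
    forall x, t1 < x <= t2 -> 0 < D (x - t1).
  move=> l0 DE x /[dup] /sin_gt0 sx /andP[tx xt].
  by rewrite -(pmulr_rgt0 _ (sqrt_gt0 x)) -DE ?(ltW tx)// mulr_gt0.
have kappaE l (D : R -> R) : 0 < l ->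
    (forall x, t1 <= x <= t2 -> l * sin (pi * (phi x - p1)) =
      Num.sqrt (q1 * derive1 phi x) * pi * D (x - t1)) ->
    kappa = l * (t2 - t1) / D (t2 - t1).
  move=> l0 DE; have t2I : t1 < t2 <= t2 by rewrite ht12 lexx.
  have := D_gt0 l D l0 DE t2 t2I; have := sin_gt0 t2 t2I.
  have := DE t2; rewrite lexx ltW// => /(_ isT).
  rewrite phi2 phi'2 /kappa => e s0 D0.
  apply/eqP; rewrite eqr_div ?lt0r_neq0//; apply/eqP.
  transitivity (Num.sqrt (q1 * q2) * pi * D (t2 - t1) * (t2 - t1)); first by ring.
  by rewrite -e; ring.
(* Each sign of m places kappa strictly below 1, strictly above 1 or at 1, so two of the three
   clauses hold vacuously. In the strict cases the square root of |m| is a valid lambda, and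
   injectivity of the ratio shows it is the only one. *)
have [m0|m0|m0] := ltgtP m 0.
- have l0 : 0 < Num.sqrt (- m) by rewrite sqrtr_gt0 oppr_gt0.
  set l := Num.sqrt (- m) in l0.
  have ll : - m = l * l by rewrite -expr2 sqr_sqrtr// oppr_ge0 ltW.
  have [x t|a [b [c [d [abcd tanE DE]]]]] :=
    mP _ _ l l (fun u => sinh (l * u)) l0 ll (fundamental_pair_hyperbolic l).
    by rewrite mulrBr sinhB.
  have lT0 : 0 < l * (t2 - t1) by rewrite mulr_gt0.
  have kE := kappaE l (fun u => sinh (l * u)) l0 DE.
  have k1 : kappa < 1.
    by rewrite kE ltr_pdivrMr ?sinh_gt0// mul1r id_lt_sinh.
  exists a, b, c, d; split => //; split => [k|k|_].
  + by move: k; rewrite ltNge ltW.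
  + by move: k1; rewrite k ltxx.
  + split; first by exists l.
    move=> l' [l'0 l'E] tau tauI.
    have -> : l' = l.
      apply: (mulIf (lt0r_neq0 T0)); apply: sinh_ratio_inj; rewrite ?mulr_gt0//.
      by rewrite l'E kE.
    rewrite hpsi// tanE// /ratio /tanh; congr moebius.
    by rewrite gt_eqF// cosh_gt0.
- have l0 : 0 < Num.sqrt m by rewrite sqrtr_gt0.
  set l := Num.sqrt m in l0.
  have ll : - m = (- l) * l by rewrite mulNr -expr2 sqr_sqrtr// ltW.
  have [x t|a [b [c [d [abcd tanE DE]]]]] :=
    mP _ _ (- l) l (fun u => sin (l * u)) l0 ll (fundamental_pair_trig l).
    by rewrite mulrBr sinB.
  have lT0 : 0 < l * (t2 - t1) by rewrite mulr_gt0.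
  have lTpi : l * (t2 - t1) < pi.
    (* Otherwise t1 + pi / l would lie in ]t1, t2], where sin (l (x - t1)) is positive, yet there it
       equals sin pi = 0. *)
    rewrite ltNge; apply/negP => piT.
    have xI : t1 < t1 + pi / l <= t2.
      by rewrite ltrDl divr_gt0 ?pi_gt0//= -lerBrDl ler_pdivrMr// mulrC.
    have := D_gt0 l (fun u => sin (l * u)) l0 DE _ xI.
    by rewrite addrAC subrr add0r mulrC divfK ?lt0r_neq0// sinpi ltxx.
  have sT0 : 0 < sin (l * (t2 - t1)) by apply: sin_gt0_pi; rewrite lT0.
  have kE := kappaE l (fun u => sin (l * u)) l0 DE.
  have k1 : 1 < kappa.
    by rewrite kE ltr_pdivlMr// mul1r sin_lt_id.
  exists a, b, c, d; split => //; split => [_|k|k].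
  + split; first by exists l; split; rewrite ?ltr_pdivlMr.
    move=> l' [l'0 l'pi l'E] tau tauI.
    have -> : l' = l.
      apply: (mulIf (lt0r_neq0 T0)); apply: sin_ratio_inj.
      * by rewrite mulr_gt0//= -ltr_pdivlMr.
      * by rewrite lT0.
      * by rewrite l'E kE.
    by rewrite hpsi// tanE.
  + by move: k1; rewrite k ltxx.
  + by move: k; rewrite ltNge ltW.
- have e0 : - m = 0 * 1 by rewrite m0 mul0r oppr0.
  have [x t|a [b [c [d [abcd tanE DE]]]]] :=
    mP _ _ 0 1 (fun u => u) ltr01 e0 fundamental_pair_affine.
    by rewrite mulr1 mul1r.
  have kE : kappa = 1.
    by rewrite (kappaE 1 (fun u => u) ltr01 DE) mul1r divff ?lt0r_neq0.
  exists a, b, c, d; split => //; split; rewrite kE ?ltxx// => _ tau tauI.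
  by rewrite hpsi// tanE// /ratio oner_eq0 divr1.
Qed.
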